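(* Let $f\in\mathbb{Q}[x]$ with $\deg f=d\ge1$ be cyclotomic-free, and let $t,c\in\mathbb{N}$ with $t\ge2$ be such that $f$ has a nonzero $t$-sparse multiple with height at most $c$. Let $n$ be the smallest degree of any such multiple of $f$. Then $$n\le 2(t-1)B\ln B,\qquad\text{where } B=\frac12 d^2\cdot\ln^3(3d)\cdot\ln\!\left(\hat c\,(t-1)^d\right)\text{ and }\hat c=\max(c,35).$$
   Context: $f$ is cyclotomic-free if no cyclotomic polynomial $\Phi_n$ ($n\ge1$) divides $f$. A polynomial is $t$-sparse if it has at most $t$ nonzero coefficients in the power basis. Height: for nonzero $g\in\mathbb{Q}[x]$, let $r$ be the least positive rational with $rg\in\mathbb{Z}[x]$; if $rg=\sum_i a_ix^{e_i}$ with $a_i\in\mathbb{Z}$, then $H(g)=\max_i|a_i|$. *)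

(* Defs.v *)
From Stdlib Require Import Reals.
From mathcomp Require Import all_boot all_order all_algebra all_field.
Set Implicit Arguments. Unset Strict Implicit. Unset Printing Implicit Defensive.
Import Order.TTheory GRing.Theory Num.Theory.
Local Open Scope ring_scope.

Definition cyclotomic_free (f : {poly rat}) : Prop :=
  forall n : nat, (0 < n)%N -> ~~ (map_poly intr ('Phi_n) %| f).

Definition nnz_coefs (g : {poly rat}) : nat :=
  #|[set i : 'I_(size g) | g`_i != 0]|.

Definition sparse (t : nat) (g : {poly rat}) : Prop := (nnz_coefs g <= t)%N.

Definition integral_poly (g : {poly rat}) : Prop :=
  forall i : nat, g`_i \is a Num.int.

Definition is_height (g : {poly rat}) (h : rat) : Prop :=
  g != 0 /\
  exists r : rat, [/\ 0 < r, integral_poly (r *: g),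
    (forall r' : rat, 0 < r' -> integral_poly (r' *: g) -> r <= r') &
    h = \big[Num.max/0]_(i < size g) `|(r *: g)`_i| ].

Definition height_le (g : {poly rat}) (c : nat) : Prop :=
  exists h : rat, is_height g h /\ h <= c%:R.

Definition good_multiple (f : {poly rat}) (t c : nat) (g : {poly rat}) : Prop :=
  [/\ g != 0, f %| g, sparse t g & height_le g c].

Local Close Scope ring_scope.
Local Open Scope R_scope.

Definition chat (c : nat) : R := Rmax (INR c) 35.
Definition Bconst (d t c : nat) : R :=
  / 2 * (INR d) ^ 2 * (ln (3 * INR d)) ^ 3 * ln (chat c * (INR t - 1) ^ d).
Definition bound4p5 (d t c : nat) : R :=
  2 * (INR t - 1) * Bconst d t c * ln (Bconst d t c).

(* Main.v *)
(** Suppose a multiple [g = g0 + x^k g1] of [f] has a gap of length [u] below the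
    exponent [k], and let [x] be a nonzero root of an irreducible factor [q] of [f],
    of degree [e], with [x] a root of [g] but not of [g0].  By the gap, [g1(x) x^j]
    is an algebraic integer for [0 <= j <= u], and Gauss' lemma turns this into
    [M(q)^u <= C^e], where [M] is the Mahler measure and [C] bounds the sums of
    the absolute values of the coefficients of [g0] and [g1].

    Conversely, [M(q)] is not too close to 1.  For a prime [p > e + 1] the numbers
    [x_i^p] attached to the conjugates [x_i] of [x] are pairwise distinct and differ
    from the [x_i].  The square of the Vandermonde determinant of these [2e] numbers
    is a nonzero integer divisible by [p^(2e)], since [q(X^p) = q(X)^p] modulo [p],
    while Hadamard's inequality bounds it by [(2e)^(2e) M(q)^(2(2e-1)(p+1))].  With [p]
    slightly above [4e] this gives [log M(q) >= 1/(3.4 e ln^3(3d))], so a long gap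
    forces [g0] to vanish at every root of [f].  Multiplicities are handled by
    applying powers of [X d/dX], which costs the factor [ln B].  Hence a multiple of
    smallest degree has no long gap. *)
Require Import Defs.
From Stdlib Require Import Reals Lra Lia Psatz.

(** * Real estimates *)

Section RealEstimates.
Local Open Scope R_scope.

Lemma exp_sqr_ge (a x : R) : 0 <= a -> a <= exp x -> a * a <= exp (2 * x).
Proof.
intros a0 ax; replace (2 * x) with (x + x) by ring; rewrite exp_plus.
apply Rmult_le_compat; lra.
Qed.

(** Five squarings, each rounded down, lead from [exp x >= 1 + x] at [x = -0.68/32] to
    [exp (-0.68) >= 0.502 > 1/2]. *)
Lemma ln2_ge : 68 / 100 <= ln 2.
Proof.
assert (h0 : 97875 / 100000 <= exp (- 2125 / 100000)).
{ apply Rlt_le, Rle_lt_trans with (1 + - 2125 / 100000); [lra | apply exp_ineq1; lra]. }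
assert (step : forall a b x, 0 <= a -> a <= exp x -> b <= a * a -> b <= exp (2 * x)).
{ intros a b x a0 ax ba; apply Rle_trans with (a * a); [easy | now apply exp_sqr_ge]. }
assert (h1 := step (97875 / 100000) (9579 / 10000) _ ltac:(lra) h0 ltac:(lra)).
assert (h2 := step (9579 / 10000) (9175 / 10000) _ ltac:(lra) h1 ltac:(lra)).
assert (h3 := step (9175 / 10000) (8418 / 10000) _ ltac:(lra) h2 ltac:(lra)).
assert (h4 := step (8418 / 10000) (7086 / 10000) _ ltac:(lra) h3 ltac:(lra)).
assert (h5 := step (7086 / 10000) (502 / 1000) _ ltac:(lra) h4 ltac:(lra)).
replace (2 * (2 * (2 * (2 * (2 * (-2125 / 100000)))))) with (- (68 / 100)) in h5 by field.
rewrite exp_Ropp in h5.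
assert (p := exp_pos (68 / 100)).
assert (h6 : exp (68 / 100) <= 2).
{ apply Rmult_le_reg_r with (/ exp (68 / 100)); [now apply Rinv_0_lt_compat |].
  rewrite Rinv_r; lra. }
rewrite <- (ln_exp (68 / 100)).
destruct h6 as [h6 | h6]; [left; now apply ln_increasing | right; now rewrite h6].
Qed.

Lemma ln_le (x y : R) : 0 < x -> x <= y -> ln x <= ln y.
Proof.
intros x0 [xy | ->]; [left; now apply ln_increasing | right; reflexivity].
Qed.

Lemma ln3_ge : 102 / 100 <= ln 3.
Proof.
assert (h : ln (2 * 2 * 2) <= ln (3 * 3)) by (apply ln_le; lra).
rewrite !ln_mult in h; try lra.
assert (h2 := ln2_ge); lra.
Qed.

Lemma ln_le_sub1 (x : R) : 0 < x -> ln x <= x - 1.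
Proof.
intros x0; destruct (Req_dec (ln x) 0) as [e | ne].
- assert (x = 1) by (rewrite <- (exp_ln x x0), e; apply exp_0); lra.
- assert (h := exp_ineq1 (ln x) ne); rewrite exp_ln in h; lra.
Qed.

Lemma ln_3d_ge (d : R) : 2 <= d -> 170 / 100 <= ln (3 * d).
Proof.
intros d2; apply Rle_trans with (ln (3 * 2)); [| apply ln_le; lra].
rewrite ln_mult; try lra; assert (a := ln2_ge); assert (b := ln3_ge); lra.
Qed.

Lemma cube_le (x y : R) : 0 <= x -> x <= y -> x ^ 3 <= y ^ 3.
Proof. intros; now apply pow_incr. Qed.

Lemma ln32_ge : 34 / 10 <= ln 32.
Proof.
replace 32 with (2 ^ 5) by ring; rewrite ln_pow; [| lra].
simpl INR; assert (h := ln2_ge); lra.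
Qed.

(** The primes 5, 13 and 61 exceed [4e] for [e = 1], [e <= 3] and [e <= 15]. The values 1.70 and
    2.38 are lower bounds for [ln 6] and [ln 12]. *)
Lemma budget_small (e d p : R) : 1 <= e -> e <= d -> 2 <= d ->
  (e = 1 /\ p = 5) \/ (2 <= e /\ e <= 3 /\ p = 13) \/ (4 <= e /\ p = 61) ->
  (2 * e - 1) * (p + 1) <= 34 / 10 * e ^ 2 * ln (3 * d) ^ 3 * ln 2.
Proof.
intros e1 ed d2 cases.
assert (h2 := ln2_ge).
assert (key : forall y, 0 <= y -> y <= ln (3 * d) ->
   (2 * e - 1) * (p + 1) <= 34 / 10 * e ^ 2 * y ^ 3 * (68 / 100) ->
   (2 * e - 1) * (p + 1) <= 34 / 10 * e ^ 2 * ln (3 * d) ^ 3 * ln 2).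
{ intros y y0 yd h; apply Rle_trans with (1 := h).
  assert (y3 := cube_le _ _ y0 yd).
  assert (0 <= y ^ 3) by now apply pow_le.
  assert (0 <= e ^ 2) by (apply pow_le; lra).
  apply Rmult_le_compat; try lra.
  - apply Rmult_le_pos; lra.
  - apply Rmult_le_compat_l; lra. }
assert (b := ln_3d_ge d d2).
destruct cases as [[-> ->] | [[e2 [e3 ->]] | [e4 ->]]].
- apply (key (170 / 100)); lra.
- apply (key (170 / 100)); try lra. nra.
- apply (key (238 / 100)); try lra.
  + apply Rle_trans with (ln (3 * (2 * 2))); [| apply ln_le; lra].
    rewrite !ln_mult; try lra; assert (h3 := ln3_ge); lra.
  + nra.
Qed.

Lemma budget_large (e d p s : R) : 16 <= e -> e <= d -> 5 <= s ->
  (s - 1) * ln 2 <= ln e -> p <= 8 * e * (s + 1) ->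
  (2 * e - 1) * (p + 1) <= 34 / 10 * e ^ 2 * ln (3 * d) ^ 3 * ln 2.
Proof.
intros e16 ed s5 se ps.
assert (h2 := ln2_ge); assert (h3 := ln3_ge).
assert (yd : 374 / 100 + 68 / 100 * (s - 5) <= ln (3 * d)).
{ apply Rle_trans with (ln (3 * e)); [| apply ln_le; lra].
  rewrite ln_mult; try lra; nra. }
set (v := s - 5) in *.
assert (v0 : 0 <= v) by (unfold v; lra).
assert (y3 := cube_le (374 / 100 + 68 / 100 * v) _ ltac:(lra) yd).
(* Tangent line of the cube at [v = 0], rounded down. It suffices because the bound on [p / e] is
   linear in [s]. *)
assert (lo : 52 + 28 * v <= (374 / 100 + 68 / 100 * v) ^ 3).
{ simpl; nra. }
assert (mid : (2 * e - 1) * (p + 1) <= e ^ 2 * (16 * (s + 1) + 1 / 8)).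
{ apply Rle_trans with (2 * e * (8 * e * (s + 1) + 1)).
  - apply Rle_trans with ((2 * e - 1) * (8 * e * (s + 1) + 1)); [apply Rmult_le_compat_l; lra |].
    apply Rmult_le_compat_r; nra.
  - nra. }
apply Rle_trans with (1 := mid).
replace s with (v + 5) by (unfold v; ring).
apply Rle_trans with (34 / 10 * e ^ 2 * (52 + 28 * v) * (68 / 100)); [nra |].
assert (0 <= e ^ 2) by (apply pow_le; lra).
apply Rmult_le_compat; try lra.
- apply Rmult_le_pos; lra.
- apply Rmult_le_compat_l; lra.
Qed.

(** If [u = r (2Bb)] with [r > 1], then [ln u <= 2b + r - 1], because [2b <= B] and [ln r <= r - 1].
    With [(l+1) e <= d] the hypothesis becomes [(l+1)^2 r L b <= 3.4 (L + l (2b + r - 1))], which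
    fails since [L, b >= 3.4], using [(l+1)^2 >= 4l] when [l >= 1]. *)
Lemma gap_size_bound (u X L b B d e l : R) :
  0 < u -> 0 < X -> 34 / 10 <= L -> 32 <= B -> b = ln B -> 2 <= d -> 1 <= e ->
  l = 0 \/ 1 <= l -> (l + 1) * e <= d -> B = / 2 * d ^ 2 * X * L ->
  u <= 34 / 10 * e ^ 2 * X * (L + l * ln u) -> u <= 2 * B * b.
Proof.
intros u0 X0 L3 B32 bE d2 e1 lcase led BE hu.
assert (b3 : 34 / 10 <= b).
{ rewrite bE; apply Rle_trans with (1 := ln32_ge); apply ln_le; lra. }
destruct (Rle_or_lt u (2 * B * b)) as [|lt]; [easy | exfalso].
assert (U0pos : 0 < 2 * B * b) by nra.
pose (r := u / (2 * B * b)).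
assert (uE : u = r * (2 * B * b)) by (unfold r; field; lra).
assert (r1 : 1 < r).
{ apply Rmult_lt_reg_r with (2 * B * b); lra. }
assert (lnU : ln (2 * B * b) <= 2 * b).
{ replace (2 * B * b) with (B * (2 * b)) by ring.
  rewrite ln_mult, <- bE; try lra.
  assert (ln (2 * b) <= b); [| lra].
  rewrite bE at 2; apply ln_le; [lra |].
  assert (h := ln_le_sub1 (B / 2) ltac:(lra)).
  assert (h2 : ln B = ln (B / 2) + ln 2) by (rewrite <- ln_mult; try lra; f_equal; field).
  assert (h3 := ln_le_sub1 2 ltac:(lra)).
  lra. }
assert (lnu : ln u <= 2 * b + r - 1).
{ rewrite uE, ln_mult; try lra. assert (h := ln_le_sub1 r ltac:(lra)); lra. }
assert (hu2 : u <= 34 / 10 * e ^ 2 * X * (L + l * (2 * b + r - 1))).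
{ apply Rle_trans with (1 := hu); apply Rmult_le_compat_l; [|].
  - apply Rmult_le_pos; [| lra]. assert (0 <= e ^ 2) by (apply pow_le; lra). lra.
  - assert (0 <= l) by lra. apply Rplus_le_compat_l, Rmult_le_compat_l; lra. }
set (W := L + l * (2 * b + r - 1)) in *.
assert (W0 : 0 <= W) by (unfold W; destruct lcase; nra).
assert (hd : (l + 1) ^ 2 * e ^ 2 <= d ^ 2).
{ rewrite <- Rpow_mult_distr; apply pow_incr; split; [destruct lcase; nra | easy]. }
assert (key : (l + 1) ^ 2 * (r * (L * b)) <= 34 / 10 * W).
{ apply Rmult_le_reg_r with (d ^ 2 * X).
  { apply Rmult_lt_0_compat; [apply pow_lt; lra | easy]. }
  replace ((l + 1) ^ 2 * (r * (L * b)) * (d ^ 2 * X)) with ((l + 1) ^ 2 * u)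
    by (rewrite uE, BE; field).
  apply Rle_trans with ((l + 1) ^ 2 * (34 / 10 * e ^ 2 * X * W)).
  - apply Rmult_le_compat_l; [apply pow2_ge_0 | easy].
  - replace ((l + 1) ^ 2 * (34 / 10 * e ^ 2 * X * W)) with (34 / 10 * X * W * ((l + 1) ^ 2 * e ^ 2)) by ring.
    replace (34 / 10 * W * (d ^ 2 * X)) with (34 / 10 * X * W * d ^ 2) by ring.
    apply Rmult_le_compat_l; [| easy].
    apply Rmult_le_pos; [lra | easy]. }
assert (Lb1 : 34 / 10 * L <= L * b) by nra.
assert (Lb2 : 34 / 10 * b <= L * b) by nra.
assert (Lb3 : 34 / 10 <= L * b) by nra.
assert (rLb : L * b < r * (L * b)) by nra.
unfold W in key; destruct lcase as [l0 | l1].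
- rewrite l0 in key; simpl in key; nra.
- assert (h4 : 4 * l * (r * (L * b)) <= (l + 1) ^ 2 * (r * (L * b))).
  { apply Rmult_le_compat_r; [nra |]. assert (h := pow2_ge_0 (l - 1)); simpl in *; lra. }
  assert (h5 : 34 / 10 * r <= r * (L * b)) by nra.
  assert (h6 : 34 / 10 * (L + l * (2 * b + r - 1)) <= l * (34 / 10 * (L + 2 * b + r - 1))) by nra.
  nra.
Qed.

Lemma ln_pow_le1 (x : R) (n : nat) : 1 <= x -> 0 <= ln (x ^ n).
Proof.
intros x1; rewrite <- ln_1; apply ln_le; [lra |]; now apply pow_R1_Rle.
Qed.

(** * The bound as a function of the degree, and what a gap inequality implies *)

Section Bound.
Context (t c : nat) (t2 : 1 <= INR t - 1).

Let T := INR t - 1.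
Let L d := ln (chat c * T ^ d).

Lemma chat_ge35 : 35 <= chat c. Proof. apply Rmax_r. Qed.
Lemma chat_ge : INR c <= chat c. Proof. apply Rmax_l. Qed.

Lemma log_factor d : L d = ln (chat c) + INR d * ln T.
Proof.
assert (h := chat_ge35); assert (h2 := pow_lt T d ltac:(unfold T; lra)).
unfold L; rewrite ln_mult; try lra; rewrite ln_pow; [lra | unfold T; lra].
Qed.

Lemma lnT_ge0 : 0 <= ln T.
Proof. rewrite <- (pow_1 T); now apply ln_pow_le1. Qed.

Lemma log_factor_ge d : 34 / 10 <= L d.
Proof.
rewrite log_factor; assert (h := chat_ge35); assert (h2 := lnT_ge0).
assert (h3 := ln32_ge); assert (h4 := ln_le 32 (chat c) ltac:(lra) ltac:(lra)).
assert (h5 := pos_INR d); nra.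
Qed.

Lemma log_factor_succ d : L d <= L (S d).
Proof. rewrite !log_factor, S_INR; assert (h := lnT_ge0); lra. Qed.

Lemma Bconst_E d : Bconst d t c = / 2 * INR d ^ 2 * ln (3 * INR d) ^ 3 * L d.
Proof. reflexivity. Qed.

Lemma log3_cube_ge d : 2 <= d -> 49 / 10 <= ln (3 * d) ^ 3.
Proof.
intros d2; apply Rle_trans with ((170 / 100) ^ 3); [lra |].
apply cube_le; [lra | now apply ln_3d_ge].
Qed.

Lemma Bconst_ge32 d : 2 <= INR d -> 32 <= Bconst d t c.
Proof.
intros d2; rewrite Bconst_E.
assert (h := log3_cube_ge _ d2); assert (h2 := log_factor_ge d).
apply Rle_trans with (/ 2 * 2 ^ 2 * (49 / 10) * (34 / 10)); [lra |].
apply Rmult_le_compat; try lra.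
apply Rmult_le_compat; try lra.
apply Rmult_le_compat_l; [lra |]; apply pow_incr; lra.
Qed.

Lemma Bconst_succ d : 2 <= INR d -> Bconst d t c + 1 <= Bconst (S d) t c.
Proof.
intros d2; rewrite !Bconst_E.
assert (h := log3_cube_ge _ d2); assert (h2 := log_factor_ge d).
assert (h3 := log_factor_succ d).
assert (y : ln (3 * INR d) ^ 3 <= ln (3 * INR (S d)) ^ 3).
{ apply cube_le; [| apply ln_le; rewrite ?S_INR; lra].
  assert (a := ln_3d_ge _ d2); lra. }
apply Rle_trans with (/ 2 * INR (S d) ^ 2 * (ln (3 * INR d) ^ 3 * L d)).
- rewrite S_INR; set (P := ln (3 * INR d) ^ 3 * L d).
  assert (hP : 1 <= P) by (unfold P; nra).
  replace (/ 2 * INR d ^ 2 * ln (3 * INR d) ^ 3 * L d) with (/ 2 * INR d ^ 2 * P) by (unfold P; ring).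
  nra.
- rewrite Rmult_assoc.
  assert (0 <= INR (S d) ^ 2) by apply pow2_ge_0.
  replace (/ 2 * INR (S d) ^ 2 * ln (3 * INR (S d)) ^ 3 * L (S d))
    with (/ 2 * INR (S d) ^ 2 * (ln (3 * INR (S d)) ^ 3 * L (S d))) by ring.
  rewrite <- Rmult_assoc; apply Rmult_le_compat_l; [lra |].
  apply Rmult_le_compat; lra.
Qed.

Lemma bound_succ d : 2 <= INR d -> bound4p5 d t c + 1 <= bound4p5 (S d) t c.
Proof.
intros d2; unfold bound4p5; fold T.
assert (h := Bconst_ge32 _ d2); assert (h2 := Bconst_succ _ d2).
set (B := Bconst d t c) in *; set (B' := Bconst (S d) t c) in *.
assert (b3 : 34 / 10 <= ln B).
{ apply Rle_trans with (1 := ln32_ge); apply ln_le; lra. }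
assert (bb : ln B <= ln B') by (apply ln_le; lra).
assert (hT : 1 <= T) by easy.
assert (h3 : B * ln B + 1 <= B' * ln B') by nra.
rewrite !Rmult_assoc; nra.
Qed.

(** Pays for a factor [X^s] of [f], which raises the degree of a multiple by [s]. *)
Lemma bound_add d s : 2 <= INR d -> bound4p5 d t c + INR s <= bound4p5 (d + s) t c.
Proof.
intros d2; induction s as [|s IH]; [rewrite Nat.add_0_r; simpl; lra |].
rewrite Nat.add_succ_r, S_INR.
assert (h := bound_succ (d + s)); rewrite plus_INR in h.
assert (h2 := pos_INR s); specialize (h ltac:(lra)); lra.
Qed.

(** Settles the case where [f] is a power of [X] times a factor of degree at most one: a scalar
    multiple of [f] is then admissible. *)
Lemma bound_ge_degree d : 1 <= INR d -> INR d <= bound4p5 d t c.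
Proof.
intros d1; unfold bound4p5; fold T.
assert (hT : 1 <= T) by easy.
destruct (Rle_or_lt 2 (INR d)) as [d2 | d2].
- assert (h := Bconst_ge32 _ d2).
  assert (hB : INR d <= Bconst d t c).
  { rewrite Bconst_E; assert (a := log3_cube_ge _ d2); assert (b := log_factor_ge d).
    assert (1 <= ln (3 * INR d) ^ 3 * L d) by nra.
    rewrite Rmult_assoc; nra. }
  assert (b3 : 34 / 10 <= ln (Bconst d t c)).
  { apply Rle_trans with (1 := ln32_ge); apply ln_le; lra. }
  assert (Bconst d t c <= Bconst d t c * ln (Bconst d t c)) by nra.
  rewrite !Rmult_assoc; nra.
- assert (d1E : d = 1%nat).
  { assert (h : (d < 2)%nat) by (apply INR_lt; simpl; lra).
    assert (h' : (0 < d)%nat) by (apply INR_lt; simpl; lra). lia. }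
  subst d; simpl INR.
  assert (hB : 18 / 10 <= Bconst 1 t c).
  { rewrite Bconst_E; assert (b := log_factor_ge 1).
    assert (y := cube_le (102 / 100) (ln (3 * INR 1)) ltac:(lra)).
    simpl INR in *; rewrite Rmult_1_r in *.
    specialize (y ln3_ge). 
    replace (/ 2 * 1 ^ 2 * ln 3 ^ 3 * L 1) with (/ 2 * (ln 3 ^ 3 * L 1)) by ring.
    assert (y' : 106 / 100 <= ln 3 ^ 3) by (simpl in *; lra).
    simpl INR in *; nra. }
  assert (b3 : 51 / 100 <= ln (Bconst 1 t c)).
  { apply Rle_trans with (ln (18 / 10)); [| apply ln_le; lra].
    assert (h : ln 3 <= ln (18 / 10 * (18 / 10))) by (apply ln_le; lra).
    rewrite ln_mult in h; try lra; assert (h3 := ln3_ge); lra. }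
  assert (h4 : 1 <= 2 * (Bconst 1 t c * ln (Bconst 1 t c))) by nra.
  nra.
Qed.

(** After taking logarithms, [p > 4e] leaves [u ln 2] on the left, and this [ln 2] cancels the one
    in the bound on [K]. What remains is the implicit inequality for [u] solved by
    [gap_size_bound]. *)
Lemma gap_bound (d e l n u p K : nat) :
  1 <= INR c -> 2 <= INR d -> 1 <= INR e -> (INR l + 1) * INR e <= INR d ->
  (0 < u)%nat -> (0 < n)%nat -> INR n <= T * INR u -> 4 * INR e < INR p ->
  INR K <= 34 / 10 * INR e ^ 2 * ln (3 * INR d) ^ 3 * ln 2 ->
  INR p ^ u <= (2 * INR e) ^ u * (INR c * T * INR n ^ l) ^ K ->
  INR n <= bound4p5 d t c.
Proof.
intros c1 d2 e1 led u0 n0 nu pe KX ineq.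
assert (hT : 1 <= T) by easy.
assert (u1 : 1 <= INR u) by (apply (le_INR 1); lia).
assert (n1 : 1 <= INR n) by (apply (le_INR 1); lia).
assert (hl := pos_INR l).
set (W := ln (INR c) + ln T + INR l * ln (INR n)).
assert (hW : INR u * ln 2 <= INR K * W).
{ assert (h := ln_le _ _ (pow_lt (INR p) u ltac:(lra)) ineq).
  assert (nl : 0 < INR n ^ l) by (apply pow_lt; lra).
  assert (cT : 0 < INR c * T) by nra.
  assert (cTn : 0 < INR c * T * INR n ^ l) by nra.
  assert (WE : ln (INR c * T * INR n ^ l) = W).
  { rewrite !ln_mult, ln_pow; unfold W; lra. }
  rewrite ln_mult, !ln_pow, WE in h; try lra; try (apply pow_lt; lra).
  assert (h2 : ln 2 + ln (2 * INR e) <= ln (INR p)).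
  { rewrite <- ln_mult; try lra; apply ln_le; lra. }
  nra. }
assert (W0 : 0 <= W).
{ assert (a := ln_le 1 (INR c)); assert (b := ln_le 1 (INR n)); rewrite ln_1 in *.
  specialize (a ltac:(lra) c1); specialize (b ltac:(lra) n1).
  assert (h := lnT_ge0); unfold W; nra. }
set (X := ln (3 * INR d) ^ 3) in *.
assert (X5 := log3_cube_ge _ d2); fold X in X5.
assert (h2 := ln2_ge).
assert (hu : INR u <= 34 / 10 * INR e ^ 2 * X * W).
{ apply Rmult_le_reg_r with (ln 2); [lra |].
  apply Rle_trans with (1 := hW).
  replace (34 / 10 * INR e ^ 2 * X * W * ln 2) with (34 / 10 * INR e ^ 2 * X * ln 2 * W) by ring.
  now apply Rmult_le_compat_r. }
assert (hWL : W <= L d + INR l * ln (INR u)).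
{ assert (lnn : ln (INR n) <= ln T + ln (INR u)).
  { rewrite <- ln_mult; try lra; apply ln_le; lra. }
  assert (lnc : ln (INR c) <= ln (chat c)) by (apply ln_le; [lra | apply chat_ge]).
  rewrite log_factor; unfold W.
  assert (h := lnT_ge0).
  (* Replacing [ln n] by [ln T + ln u] produces [(l+1) ln T], which the term [d ln T] of [L d]
     absorbs. *)
  assert (ld : INR l + 1 <= INR d) by nra.
  nra. }
assert (hu2 : INR u <= 34 / 10 * INR e ^ 2 * X * (L d + INR l * ln (INR u))).
{ apply Rle_trans with (1 := hu); apply Rmult_le_compat_l; [| easy].
  assert (0 <= INR e ^ 2) by apply pow2_ge_0.
  apply Rmult_le_pos; lra. }
assert (lcase : INR l = 0 \/ 1 <= INR l).
{ destruct l as [|l']; [now left | right; apply (le_INR 1); lia]. }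
assert (fin := gap_size_bound (INR u) X (L d) (ln (Bconst d t c)) (Bconst d t c) (INR d) (INR e) (INR l)
  ltac:(lra) ltac:(lra) (log_factor_ge d) (Bconst_ge32 _ d2) eq_refl d2 e1 lcase led eq_refl hu2).
apply Rle_trans with (1 := nu); unfold bound4p5; fold T.
replace (2 * T * Bconst d t c * ln (Bconst d t c)) with (T * (2 * Bconst d t c * ln (Bconst d t c))) by ring.
apply Rmult_le_compat_l; lra.
Qed.

End Bound.

(* With [(2e-1)(p+1)] below this budget, a Mahler measure [M] in degree [e] satisfies
   [log M >= 1/(3.4 e ln^3(3d))]; the constant 3.4 is a lower bound for [ln B]. *)
Definition mahler_budget (e d : nat) : R :=
  34 / 10 * INR e ^ 2 * ln (3 * INR d) ^ 3 * ln 2.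

Lemma INR_budget_lhs (e p : nat) : (1 <= e)%nat ->
  INR (Nat.pred (2 * e) * S p) = (2 * INR e - 1) * (INR p + 1).
Proof.
intros e1; rewrite mult_INR, S_INR; f_equal.
rewrite <- Nat.sub_1_r, minus_INR, mult_INR; [simpl; ring | lia].
Qed.

Lemma budget_small_nat (e d p : nat) : (1 <= e)%nat -> (e <= d)%nat -> (2 <= d)%nat ->
  (e = 1 /\ p = 5)%nat \/ (2 <= e <= 3 /\ p = 13)%nat \/ (4 <= e /\ p = 61)%nat ->
  INR (Nat.pred (2 * e) * S p) <= mahler_budget e d.
Proof.
intros e1 ed d2 cases; rewrite INR_budget_lhs; [| easy].
apply budget_small.
- now apply (le_INR 1).
- now apply le_INR.
- now apply (le_INR 2).
- destruct cases as [[-> ->] | [[[e2 e3] ->] | [e4 ->]]].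
  + left; simpl; lra.
  + apply le_INR in e2; apply le_INR in e3; right; left; simpl in *; lra.
  + apply le_INR in e4; right; right; simpl in *; lra.
Qed.

Lemma budget_large_nat (e d p s : nat) : (16 <= e)%nat -> (e <= d)%nat -> (5 <= s)%nat ->
  2 ^ (s - 1) <= INR e -> (p <= 8 * e * S s)%nat ->
  INR (Nat.pred (2 * e) * S p) <= mahler_budget e d.
Proof.
intros e16 ed s5 se ps; rewrite INR_budget_lhs; [| lia].
apply le_INR in e16; apply le_INR in ed; apply le_INR in ps.
rewrite !mult_INR, (S_INR s) in ps; replace (INR 8) with 8 in ps by (simpl; ring).
apply budget_large with (INR s); simpl INR in *; try lra.
- apply le_INR in s5; simpl in s5; lra.
- replace (INR s - 1) with (INR (s - 1)) by (rewrite minus_INR; [reflexivity | lia]).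
  rewrite <- ln_pow; [| lra].
  apply ln_le; [apply pow_lt; lra | easy].
Qed.

Lemma gap_bound_nat (t c d e l n u p K : nat) :
  (2 <= t)%nat -> (1 <= c)%nat -> (2 <= d)%nat -> (1 <= e)%nat -> (S l * e <= d)%nat ->
  (1 <= u)%nat -> (1 <= n)%nat -> (n <= Nat.pred t * u)%nat -> (4 * e < p)%nat ->
  INR K <= mahler_budget e d ->
  INR p ^ u <= (2 * INR e) ^ u * (INR (Nat.pred t) * (INR c * INR n ^ l)) ^ K ->
  INR n <= bound4p5 d t c.
Proof.
intros t2 c1 d2 e1 led u1 n1 nu pe KX ineq.
assert (tE : INR (Nat.pred t) = INR t - 1).
{ rewrite <- Nat.sub_1_r, minus_INR; [reflexivity | lia]. }
apply (gap_bound t c) with (e := e) (l := l) (u := u) (p := p) (K := K); try easy.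
- apply le_INR in t2; simpl in t2; lra.
- now apply (le_INR 1).
- now apply (le_INR 2).
- now apply (le_INR 1).
- apply le_INR in led; rewrite mult_INR, S_INR in led; easy.
- rewrite <- tE, <- mult_INR; now apply le_INR.
- apply lt_INR in pe; rewrite mult_INR in pe; simpl in *; lra.
- rewrite tE in ineq; rewrite <- (Rmult_assoc _ (INR c)), (Rmult_comm _ (INR c)) in ineq; easy.
Qed.

Lemma INR_sub1_ge1 (t : nat) : (2 <= t)%nat -> 1 <= INR t - 1.
Proof. intros t2; apply le_INR in t2; simpl in t2; lra. Qed.

End RealEstimates.

From mathcomp Require Import all_boot all_order all_algebra all_field.
From mathcomp Require Import zify ring.
Set Implicit Arguments. Unset Strict Implicit. Unset Printing Implicit Defensive.

(** * Primes *)

Lemma logn_fact_trunc p n m : prime p -> n < p ^ m.+1 ->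
  logn p n`! = \sum_(1 <= k < m.+1) n %/ p ^ k.
Proof.
move=> pr_p lt_n; rewrite logn_fact //.
have ext a : n < p ^ a.+1 -> forall b, a <= b ->
    \sum_(1 <= k < b.+1) n %/ p ^ k = \sum_(1 <= k < a.+1) n %/ p ^ k.
  move=> lt_a b le_ab; rewrite (@big_cat_nat _ _ _ a.+1) //= -[RHS]addn0; congr (_ + _).
  rewrite big_nat_cond big1 // => k /andP[/andP[ak _] _].
  by rewrite divn_small // (leq_trans lt_a) // leq_pexp2l // prime_gt0.
have lt_nn : n < p ^ n.+1 by rewrite (ltn_trans (ltnSn n)) // ltn_expl // prime_gt1.
by rewrite -(ext _ lt_nn (maxn n m)) ?leq_maxl // -(ext _ lt_n (maxn n m)) ?leq_maxr.
Qed.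

(** By Legendre's formula the exponent is the sum over [k] of [(2n) %/ p^k - 2 (n %/ p^k)]. Each
    term is at most 1, and those with [p^k > 2n] vanish. *)
Lemma prime_power_central_binomial p n : prime p -> 0 < n ->
  p ^ logn p 'C(2 * n, n) <= 2 * n.
Proof.
move=> pr_p n_gt0; have n2 : 0 < 2 * n by rewrite muln_gt0.
have p_gt1 := prime_gt1 pr_p.
set t := trunc_log p (2 * n).
have lt_t : 2 * n < p ^ t.+1 by apply: trunc_log_ltn.
apply: leq_trans (trunc_logP p_gt1 n2); rewrite leq_exp2l // -/t.
have le_n2 : n <= 2 * n by rewrite leq_pmull.
have := congr1 (logn p) (bin_fact le_n2).
rewrite !lognM ?muln_gt0 ?fact_gt0 ?bin_gt0 //.
rewrite (_ : 2 * n - n = n); last lia.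
rewrite (logn_fact_trunc pr_p lt_t) (logn_fact_trunc pr_p (leq_ltn_trans le_n2 lt_t)).
move=> E; have : \sum_(1 <= k < t.+1) (2 * n) %/ p ^ k
    <= \sum_(1 <= k < t.+1) (1 + (n %/ p ^ k + n %/ p ^ k)).
  apply: leq_sum => k _; have pk : 0 < p ^ k by rewrite expn_gt0 ltnW.
  rewrite -ltnS ltn_divLR //.
  have := divn_eq n (p ^ k); have := ltn_pmod n pk.
  move: (p ^ k) (n %/ p ^ k) (n %% p ^ k) => P q r lt_r nE.
  by rewrite !mulSn !mulnDl; lia.
by rewrite -E !big_split /= sum_nat_const_nat subn1 muln1 leq_add2r.
Qed.

(** Vandermonde's convolution writes the left-over binomial as the sum of the squares of the
    ['C(n, i)], which dominates their plain sum [2^n]. *)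
Lemma central_binomial_ge n : 2 ^ n <= 'C(2 * n, n).
Proof.
rewrite mul2n -addnn -binomial.Vandermonde (expnDn 1 1 n).
apply: leq_sum => i _.
have le_in : i <= n by rewrite -ltnS.
by rewrite !exp1n !muln1 (bin_sub le_in) -[X in X <= _]muln1 leq_mul // bin_gt0.
Qed.

(* If all prime factors of ['C(2n, n)] with [n = dw] were at most [4d], there would be
   at most [2d] of them, each contributing a prime power at most [2n]. *)
Lemma prime_above d w : 0 < d -> 0 < w -> (2 * (d * w)) ^ (2 * d) < 2 ^ (d * w) ->
  exists p, [/\ prime p, 4 * d < p & p <= 2 * (d * w)].
Proof.
move=> d0 w0; set n := d * w => lt_pow.
have n0 : 0 < n by rewrite muln_gt0 d0.
set c := 'C(2 * n, n).
have c0 : 0 < c by rewrite bin_gt0 leq_pmull.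
have [/hasP[p pc lt_p]|/hasPn small] := boolP (has (fun p => 4 * d < p) (primes c)).
  move: pc; rewrite mem_primes => /and3P[pr_p _ pc]; exists p; split=> //.
  have le_n2 : n <= 2 * n by rewrite leq_pmull.
  have : p %| (2 * n)`! by rewrite -(bin_fact le_n2) dvdn_mulr.
  rewrite leqNgt; apply: contraL => lt_np.
  rewrite fact_prod; elim: (2 * n) lt_np => [|m IH] lt_mp.
    by rewrite big_nil dvdn1; case: p pr_p {lt_p pc lt_mp} => [|[|]].
  rewrite big_nat_recr //= Euclid_dvdM // negb_or IH ?(ltn_trans _ lt_mp) //.
  by rewrite gtnNdvd.
(* [uphalf] sends 2 to 1 and an odd prime [p] to [(p+1)/2 >= 2], so it is injective on primes and
   maps those up to [4d] into [1..2d]. *)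
have : size (primes c) <= size (iota 1 (2 * d)).
  rewrite -(size_map uphalf); apply: uniq_leq_size.
    rewrite map_inj_in_uniq ?primes_uniq // => p q; rewrite !mem_primes => /and3P[pp _ _] /and3P[pq _ _].
    have := odd_double_half p; have := odd_double_half q; rewrite !uphalf_half.
    have := prime_gt1 pp; have := prime_gt1 pq.
    by case: (even_prime pp) => [->|->]; case: (even_prime pq) => [->|->] /=; lia.
  move=> _ /mapP[p pc ->]; have := small _ pc; move: pc; rewrite mem_primes => /and3P[pp _ _].
  rewrite mem_iota -leqNgt uphalf_half; have := prime_gt1 pp; have := odd_double_half p.
  by case: (odd p) => /=; lia.
rewrite size_iota => le_size.
suff : c <= (2 * n) ^ (2 * d) by rewrite leqNgt (leq_trans lt_pow) // central_binomial_ge.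
apply: leq_trans (_ : _ <= (2 * n) ^ size (primes c)) _; last by rewrite leq_pexp2l // muln_gt0.
rewrite [X in X <= _](prod_prime_decomp c0) prime_decompE big_map /=.
have : {in primes c, forall p, p ^ logn p c <= 2 * n}.
  by move=> p; rewrite mem_primes => /andP[pp _]; apply: prime_power_central_binomial.
elim: (primes c) => [|p s IH] le_s; first by rewrite big_nil.
rewrite big_cons /= expnS leq_mul ?le_s ?mem_head // IH // => q qs.
by rewrite le_s // inE qs orbT.
Qed.

Import Order.TTheory GRing.Theory Num.Theory.
Local Open Scope ring_scope.

Lemma INR_expn a n : INR (a ^ n)%N = Rpow_def.pow (INR a) n.
Proof. by elim: n => [|n IH] //; rewrite expnS mult_INR IH. Qed.

Lemma prime_choice (e d : nat) : (0 < e <= d)%N -> (2 <= d)%N ->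
  exists p, [/\ prime p, (4 * e < p)%N & Rle (INR ((2 * e).-1 * p.+1)) (mahler_budget e d)].
Proof.
move=> /andP[e0 ed] d2.
have small p : (e = 1 /\ p = 5)%N \/ ((le 2 e /\ le e 3) /\ p = 13)%N \/ (le 4 e /\ p = 61)%N ->
    Rle (INR ((2 * e).-1 * p.+1)) (mahler_budget e d).
  exact: (budget_small_nat e d p (ssrnat.leP e0) (ssrnat.leP ed) (ssrnat.leP d2)).
have [e1|e1] := leqP e 1.
  by exists 5; split=> //; [lia | apply: small; left; lia].
have [e3|e3] := leqP e 3.
  by exists 13; split=> //; [lia | apply: small; right; left; lia].
have [e15|e16] := leqP e 15.
  by exists 61; split=> //; [lia | apply: small; right; right; lia].
(* [s] is the binary length of [e]. The choice [w = 4(s+1)] in [prime_above] works because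
   [2e <= 2^(s+1)] and [4(s+1) < 2^(s+1)]. *)
set s := (trunc_log 2 e).+1.
have /andP[lo hi] : (2 ^ s.-1 <= e < 2 ^ s)%N by apply: trunc_log_bounds.
have s5 : (5 <= s)%N.
  rewrite leqNgt; apply: contraL (hi) => s4; rewrite -leqNgt (leq_trans _ e16) //.
  by rewrite (@leq_pexp2l 2 s 4).
have lin : (4 * s.+1 < 2 ^ s.+1)%N.
  rewrite -(subnK s5); elim: (s - 5)%N => [|v IH] //.
  by rewrite addSn expnS; lia.
have pow_lt : ((2 * (e * (4 * s.+1))) ^ (2 * e) < 2 ^ (e * (4 * s.+1)))%N.
  rewrite expnM -[X in (_ < 2 ^ X)%N]mulnC expnM ltn_exp2r //.
  apply: (@leq_ltn_trans ((2 ^ s.+1 * (4 * s.+1)) ^ 2)).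
    by rewrite leq_exp2r // mulnA leq_mul // expnS leq_mul2l ltnW.
  apply: (@leq_trans ((2 ^ s.+1 * 2 ^ s.+1) ^ 2)).
    by rewrite ltn_exp2r // ltn_pmul2l // expn_gt0.
  by rewrite -expnD -expnM leq_exp2l //; lia.
have [//|//|p [pr_p lt_p le_p]] := prime_above _ _ pow_lt.
exists p; split=> //; apply: (@budget_large_nat e d p s); try by apply/ssrnat.leP.
  have -> : Nat.sub s 1 = s.-1 by lia.
  rewrite -[Rdefinitions.IZR _]/(INR 2) -INR_expn; exact/le_INR/ssrnat.leP.
by apply/ssrnat.leP; rewrite (leq_trans le_p) //; move: s.+1 => a; lia.
Qed.

(** * Determinants and products over the roots of a polynomial *)

(** Gram-Schmidt writes [A = L S] with [S] unitary and [L] lower triangular. Thus [|det A|] is the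
    product of the [|L i i|], each at most the norm of row [i] of [L], which equals that of row [i]
    of [A]. *)
Lemma hadamard (C : numClosedFieldType) n (A : 'M[C]_n) :
  `|\det A| ^+ 2 <= \prod_i \sum_j `|A i j| ^+ 2.
Proof.
pose S := schmidt A; pose cS : 'M[C]_n := map_mx Num.conj S^T.
have S_unitary : S \is unitarymx by apply: schmidt_unitarymx.
have SS : S *m cS = 1%:M by apply/unitarymxP.
have SS' : cS *m S = 1%:M by apply: mulmx1C.
pose L := A *m cS.
have AE : A = L *m S by rewrite -mulmxA SS' mulmx1.
have detS : `|\det S| ^+ 2 = 1.
  by rewrite normCK -(det_tr S) -det_map_mx -/cS det_tr -det_mulmx SS det1.
have L_trig : is_trig_mx L.
  apply/is_trig_mxP => i j lt_ij.
  have /sub_sumsmxP[u Ei] := row_schmidt_sub A i.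
  have -> : L i j = (row i A *m cS) 0 j.
    by rewrite -row_mul [RHS]mxE.
  rewrite Ei mulmx_suml summxE big1 // => k le_ki.
  have /submxP[v ->] : (u k *m <<row k S>> <= row k S)%MS.
    by rewrite (submx_trans (submxMl _ _)) ?genmxE.
  rewrite -mulmxA -row_mul SS row1 mxE big1 // => l _.
  rewrite mxE [X in _ * X](_ : _ = 0) ?mulr0 //= andbC; case: eqP => // jk.
  by rewrite -jk leqNgt lt_ij in le_ki.
have sq_norm (B : 'M[C]_n) i : \sum_j `|B i j| ^+ 2 = (B *m map_mx Num.conj B^T) i i.
  by rewrite mxE; apply: eq_bigr => j _; rewrite !mxE normCK.
have row_norm i : \sum_j `|L i j| ^+ 2 = \sum_j `|A i j| ^+ 2.
  rewrite !sq_norm [in RHS]AE (trmx_mul L) (map_mxM _ S^T) mulmxA -(mulmxA L).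
  by rewrite -[map_mx _ S^T]/cS SS mulmx1.

rewrite {1}AE det_mulmx normrM exprMn detS mulr1 det_trig // normr_prod -prodrXl.
apply: ler_prod => i _; rewrite exprn_ge0 //= -row_norm (bigD1 i) //=.
by rewrite lerDl sumr_ge0 // => j _; rewrite exprn_ge0.
Qed.

Lemma horner_char_poly (R : comNzRingType) n (A : 'M[R]_n) x :
  (char_poly A).[x] = \det (x%:M - A).
Proof.
rewrite /char_poly -[_.[x]]/(horner_eval x _) -det_map_mx; congr (\det _).
apply/matrixP => i j; rewrite !mxE [LHS]/= -[LHS]/((_ *+ _ - _).[x]).
by rewrite hornerD hornerN hornerC hornerMn hornerX.
Qed.

Lemma prodrN_seq (R : comNzRingType) (I : Type) (s : seq I) (F : I -> R) :
  \prod_(i <- s) - F i = (-1) ^+ size s * \prod_(i <- s) F i.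
Proof.
by elim: s => [|x s IHs]; rewrite ?big_nil ?mulr1 // !big_cons IHs exprS mulrACA mulN1r.
Qed.

Lemma prodr_const_seq (R : comNzRingType) (I : Type) (s : seq I) (x : R) :
  \prod_(i <- s) x = x ^+ size s.
Proof. by elim: s => [|y s IHs]; rewrite ?big_nil // big_cons IHs exprS. Qed.

(** Factor [h] over the closed field: for a root [y] of [h], [det (A - y)] is up to sign the
    characteristic polynomial at [y], hence the product of the [z - y]. *)
Lemma det_horner_mx (F : closedFieldType) n (A : 'M[F]_n.+1) (rs : seq F) (h : {poly F}) :
  char_poly A = \prod_(z <- rs) ('X - z%:P) ->
  \det (horner_mx A h) = \prod_(z <- rs) h.[z].
Proof.
move=> cA.
have sz_rs : size rs = n.+1.
  by have := size_char_poly A; rewrite cA size_prod_XsubC => -[].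
have [s ->] := closed_field_poly_normal h; set c := lead_coef h.
rewrite horner_mxZ rmorph_prod /= detZ.
under [RHS]eq_bigr do rewrite hornerZ horner_prod.
rewrite big_split /= prodr_const_seq sz_rs; congr (_ * _).
rewrite exchange_big /= (big_morph (fun M : 'M[F]_n.+1 => \det M) (@det_mulmx _ _) (det1 _ _)).
apply: eq_bigr => y _.
rewrite rmorphB /= horner_mx_X horner_mx_C.
rewrite -[A - _]opprK -scaleN1r detZ opprB -horner_char_poly cA horner_prod -sz_rs -prodrN_seq.
by apply: eq_bigr => z _; rewrite !hornerXsubC opprB.
Qed.

Lemma poly_ext_nat (F : numFieldType) (p q : {poly F}) :
  (forall n : nat, p.[n%:R] = q.[n%:R]) -> p = q.
Proof.
move=> e; apply/eqP; rewrite -subr_eq0; apply/negPn/negP => nz.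
pose s : seq F := [seq i%:R | i <- iota 0 (size (p - q))].
have := @max_poly_roots _ (p - q) s nz; rewrite size_map size_iota ltnn.
have -> // : all (root (p - q)) s.
  by apply/allP => _ /mapP[i _ ->]; rewrite rootE !hornerE e subrr.
rewrite map_inj_uniq ?iota_uniq // => h; first by have := h isT isT.
by move=> x /eqP; rewrite eqr_nat => /eqP.
Qed.

Section RootProducts.
Context (R : comNzRingType) (f : {rmorphism R -> algC}).

Lemma exists_companion (P : {poly R}) n :
  P \is monic -> size P = n.+1 -> exists A : 'M[R]_n, char_poly A = P.
Proof.
move=> Pmon sP; move: (companionmx P) (companionmxK Pmon).
by rewrite sP /= => A; exists A.
Qed.

(** At a natural number [k] the left side is the determinant of [k - h] evaluated at [A], so
    [det_horner_mx] applies, and agreement at all [k] is enough. *)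
Lemma char_poly_horner_mx n (A : 'M[algC]_n.+1) (rs : seq algC) (h : {poly algC}) :
  char_poly A = \prod_(z <- rs) ('X - z%:P) ->
  char_poly (horner_mx A h) = \prod_(z <- rs) ('X - h.[z]%:P).
Proof.
move=> cA; apply: poly_ext_nat => k; rewrite horner_char_poly horner_prod.
rewrite -(horner_mx_C A) -rmorphB (det_horner_mx _ cA).
by apply: eq_bigr => z _; rewrite !hornerE.
Qed.

(** The companion matrix [A] of [P] has entries in [R], and the product is the image of [det h(A)].
    Over the integers this shows that norms of integral expressions are integers. *)
Lemma prod_roots_image (P h : {poly R}) (rs : seq algC) :
  P \is monic -> map_poly f P = \prod_(z <- rs) ('X - z%:P) ->
  exists m, \prod_(z <- rs) (map_poly f h).[z] = f m.
Proof.
move=> Pmon PE.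
have sP : size P = (size rs).+1.
  by rewrite -(size_map_poly_id0 (f := f)) ?PE ?size_prod_XsubC // (monicP Pmon) rmorph1 oner_eq0.
(* [horner_mx] needs a matrix of positive size, so the empty product is treated apart. *)
case: rs => [|z0 rs] in PE sP *; first by exists 1; rewrite big_nil rmorph1.
have [A cA] := exists_companion Pmon sP.
exists (\det (horner_mx A h)); rewrite -det_map_mx map_horner_mx.
by rewrite (@det_horner_mx _ _ _ (z0 :: rs)) // -map_char_poly cA.
Qed.

Lemma poly_root_image (P h : {poly R}) (rs : seq algC) :
  P \is monic -> map_poly f P = \prod_(z <- rs) ('X - z%:P) ->
  exists2 Q : {poly R}, Q \is monic &
    map_poly f Q = \prod_(z <- rs) ('X - (map_poly f h).[z]%:P).
Proof.
move=> Pmon PE.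
have sP : size P = (size rs).+1.
  by rewrite -(size_map_poly_id0 (f := f)) ?PE ?size_prod_XsubC // (monicP Pmon) rmorph1 oner_eq0.
case: rs => [|z0 rs] in PE sP *; first by exists 1; rewrite ?monic1 // big_nil rmorph1.
have [A cA] := exists_companion Pmon sP.
exists (char_poly (horner_mx A h)); first exact: char_poly_monic.
by rewrite map_char_poly map_horner_mx (@char_poly_horner_mx _ _ (z0 :: rs)) // -map_char_poly cA.
Qed.

End RootProducts.

Lemma int_poly_mod p (P : {poly int}) : prime p ->
  map_poly (intr : int -> 'F_p) P = 0 -> exists Q : {poly int}, P = p%:Z *: Q.
Proof.
move=> pr_p P0.
exists (\poly_(i < size P) (P`_i %/ p%:Z)%Z).
apply/polyP => i; rewrite coefZ coef_poly; case: ltnP => [lt_i|le_i]; last first.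
  by rewrite mulr0 nth_default.
have : (map_poly (intr : int -> 'F_p) P)`_i == 0 by rewrite P0 coef0.
rewrite coef_map /= => Pi0.
rewrite mulrC divzK //.
have: ((absz P`_i)%:R : 'F_p) == 0.
  by move: Pi0; case: (P`_i) => k //; rewrite NegzE rmorphN oppr_eq0 abszN.
by rewrite -(dvdn_pcharf (pchar_Fp pr_p)) dvdzE.
Qed.

(** Modulo [p] the [p]-th power map is additive and fixes every coefficient, so the two sides agree
    along the Horner form of [P]. *)
Lemma frobenius_int_poly p (P : {poly int}) : prime p ->
  exists Q : {poly int}, P \Po 'X^p = P ^+ p + p%:Z *: Q.
Proof.
move=> pr_p.
suff /(int_poly_mod pr_p)[Q E] : map_poly (intr : int -> 'F_p) (P \Po 'X^p - P ^+ p) = 0.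
  by exists Q; rewrite -E addrC subrK.
rewrite rmorphB rmorphXn /= map_comp_poly map_polyXn.
apply/eqP; rewrite subr_eq0; apply/eqP.
move: (map_poly _ P) => {}P.
have chP : p \in [pchar {poly 'F_p}].
  by rewrite (rmorph_pchar (polyC : {rmorphism 'F_p -> {poly 'F_p}})) ?pchar_Fp.
elim/poly_ind: P => [|P c IH]; first by rewrite comp_poly0 expr0n; case: p pr_p {chP}.
rewrite comp_poly_MXaddC IH -!(pFrobenius_autE chP) pFrobenius_autD_comm; last exact: mulrC.
rewrite !pFrobenius_autE exprMn -polyC_exp.
congr (_ + _%:P); rewrite -[in LHS](@expf_card _ c) card_Fp //.
Qed.

(** * A lower bound for the Mahler measure *)

Local Notation pZC := (map_poly (intr : int -> algC)).

Lemma deriv_prod_XsubC (R : comNzRingType) n (a : 'I_n -> R) i :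
  (\prod_j ('X - (a j)%:P))^`().[a i] = \prod_(j | j != i) (a i - a j).
Proof.
rewrite (bigD1 i) //= derivM derivXsubC mul1r hornerD hornerM hornerXsubC subrr mul0r addr0.
by rewrite horner_prod; apply: eq_bigr => j _; rewrite hornerXsubC.
Qed.

(** Both sides are the absolute value of the discriminant: over all ordered pairs, each unordered
    pair occurs twice. *)
Lemma norm_Vandermonde_sqr (R : numDomainType) n (a : 'rV[R]_n) :
  `|\det (Vandermonde n a)| ^+ 2 = \prod_i `|(\prod_j ('X - (a 0 j)%:P))^`().[a 0 i]|.
Proof.
under [RHS]eq_bigr do rewrite deriv_prod_XsubC normr_prod.
rewrite det_Vandermonde normr_prod.
under eq_bigr do rewrite normr_prod.
rewrite expr2 [X in _ * X](exchange_big_dep xpredT) //= -big_split /=.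
apply: eq_bigr => i _.
rewrite [RHS](bigID (fun j : 'I_n => (i < j)%N)) /=; congr (_ * _).
  apply: eq_big => [j|j _]; last by rewrite distrC.
  by rewrite andb_idl // => lt; rewrite -val_eqE /= neq_ltn lt orbT.
by apply: eq_bigl => j; rewrite -leqNgt ltn_neqAle val_eqE.
Qed.

(** The contribution of one root to the Mahler measure, written with a test because the order of
    [algC] is only partial. *)
Definition max1 (z : algC) : algC := if `|z| <= 1 then 1 else `|z|.

Variant max1_spec (z : algC) : algC -> Type :=
  | Max1Small of `|z| <= 1 : max1_spec z 1
  | Max1Large of 1 < `|z| : max1_spec z `|z|.

Lemma max1P z : max1_spec z (max1 z).
Proof.
rewrite /max1; case: (real_leP (normr_real z) (real1 _)) => h; by constructor.
Qed.

Lemma max1_ge1 z : 1 <= max1 z.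
Proof. by case: max1P => // /ltW. Qed.

Lemma max1_ge0 z : 0 <= max1 z.
Proof. exact: le_trans ler01 (max1_ge1 z). Qed.

Lemma max1_ge_norm z : `|z| <= max1 z.
Proof. by case: max1P. Qed.

Lemma max1X_le z n : max1 (z ^+ n) <= max1 z ^+ n.
Proof.
case: (max1P (z ^+ n)) => _; first exact: exprn_ege1 (max1_ge1 z).
by rewrite normrX lerXn2r ?nnegrE ?max1_ge0 ?max1_ge_norm.
Qed.

(** Hadamard on the transpose: the row of powers of [a 0 i] has [n+1] entries, each of norm at most
    [max1 (a 0 i) ^+ n]. *)
Lemma vandermonde_upper n (a : 'rV[algC]_n.+1) :
  `|\det (Vandermonde n.+1 a)| ^+ 2 <=
    n.+1%:R ^+ n.+1 * (\prod_i max1 (a 0 i)) ^+ (2 * n).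
Proof.
rewrite -det_tr (le_trans (hadamard _)) //.
rewrite -prodrXl (_ : n.+1%:R ^+ n.+1 = \prod_(i < n.+1) n.+1%:R); last by rewrite prodr_const card_ord.
rewrite -big_split /=.
apply: ler_prod => i _; rewrite sumr_ge0 /= => [|j _]; last by rewrite exprn_ge0.
rewrite (_ : n.+1%:R * _ = \sum_(j < n.+1) max1 (a 0 i) ^+ (2 * n));
  last by rewrite sumr_const card_ord mulr_natl.
apply: ler_sum => j _.
rewrite !mxE normrX -exprM mulnC.
apply: (@le_trans _ _ (max1 (a 0 i) ^+ (2 * j))).
  by rewrite lerXn2r ?nnegrE ?max1_ge0 ?max1_ge_norm.
by rewrite ler_weXn2l ?max1_ge1 // leq_mul2l /= -ltnS.
Qed.

Lemma norm_int_ge1 (m : int) : m != 0 -> 1 <= `|m%:~R : algC|.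
Proof. by move=> nz; rewrite -intr_norm -[1]/(1%:~R) ler_int -gtz0_ge1 normr_gt0. Qed.

(** The nodes are the roots of [F * Fp], where [Fp] has the roots [z^p]. Up to sign, the squared
    determinant is the product over [z] of [F'(z) Fp(z)] and [F(z^p) Fp'(z^p)]; the two resultants
    supply a factor [p^d] each, and the cofactor is a nonzero integer because the nodes are
    distinct. *)
Lemma mahler_lower (F : {poly int}) (rs : seq algC) p :
  F \is monic -> pZC F = \prod_(z <- rs) ('X - z%:P) -> (0 < size rs)%N ->
  prime p -> uniq (rs ++ [seq z ^+ p | z <- rs]) ->
  p%:R ^+ (2 * size rs) <= (2 * size rs)%:R ^+ (2 * size rs)
    * (\prod_(z <- rs) max1 z) ^+ (2 * (2 * size rs).-1 * p.+1) :> algC.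
Proof.
move=> Fmon FE d_gt0 pr_p; set s := rs ++ _ => us.
set d := size rs.
have ss : size s = (2 * d)%N by rewrite size_cat size_map mul2n addnn.
have [n sn] : exists n, (2 * d = n.+1)%N by exists (2 * d).-1; rewrite prednK // muln_gt0.
pose a : 'rV[algC]_n.+1 := \row_i s`_i.
have big_a (G : algC -> algC) : \prod_i G (a 0 i) = \prod_(x <- s) G x.
  rewrite [RHS](big_nth 0) ss sn big_mkord; by apply: eq_bigr => i _; rewrite mxE.
have [Fp Fpmon FpE] := poly_root_image 'X^p Fmon FE.
have {}FpE : pZC Fp = \prod_(z <- rs) ('X - (z ^+ p)%:P).
  by rewrite FpE; apply: eq_bigr => z _; rewrite map_polyXn hornerXn.
have PE : \prod_j ('X - (a 0 j)%:P) = pZC F * pZC Fp.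
  transitivity (\prod_(x <- s) ('X - x%:P)).
    rewrite [RHS](big_nth 0) ss sn big_mkord; by apply: eq_bigr => i _; rewrite mxE.
  by rewrite big_cat /= big_map FE FpE.
have rootF z : z \in rs -> (pZC F).[z] = 0.
  by move=> zrs; apply/eqP; rewrite -rootE FE root_prod_XsubC.
have rootFp z : z \in rs -> (pZC Fp).[z ^+ p] = 0.
  move=> zrs; apply/eqP; rewrite -rootE FpE.
  by rewrite -(big_map (fun z => z ^+ p) xpredT (fun y => 'X - y%:P)) root_prod_XsubC; apply/mapP; exists z.
have [m1 E1] := prod_roots_image F^`() Fmon FE.
have [H HE] := frobenius_int_poly F pr_p.
have [m2 E2] := prod_roots_image H Fmon FE.
have [m4 E4] := prod_roots_image (Fp^`() \Po 'X^p) Fmon FE.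
(* Since [F(z) = 0], the Frobenius congruence becomes [F(z^p) = p H(z)]. *)
have E3 : \prod_(z <- rs) (pZC F).[z ^+ p] = (p ^ d)%:R * m2%:~R.
  rewrite -E2 natrX -prodr_const_seq -big_split /=; apply: eq_big_seq => z zrs.
  have := congr1 (fun P => (pZC P).[z]) HE.
  rewrite /= map_comp_poly map_polyXn horner_comp hornerXn rmorphD rmorphXn /= map_polyZ.
  rewrite hornerD horner_exp (rootF z) // expr0n hornerZ => ->.
  by case: (p) pr_p => // q _; rewrite add0r.
(* Both sides are the product of all [|z - y^p|]. *)
have E3' : \prod_(z <- rs) `|(pZC Fp).[z]| = \prod_(z <- rs) `|(pZC F).[z ^+ p]|.
  transitivity (\prod_(z <- rs) \prod_(y <- rs) `|z - y ^+ p|).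
    apply: eq_bigr => z _; rewrite FpE horner_prod normr_prod.
    by apply: eq_bigr => y _; rewrite hornerXsubC.
  rewrite exchange_big /=; apply: eq_bigr => z _; rewrite FE horner_prod normr_prod.
  by apply: eq_bigr => y _; rewrite hornerXsubC distrC.
have detE : `|\det (Vandermonde n.+1 a)| ^+ 2 = ((p ^ d)%:R ^+ 2) * `|(m1 * m4 * m2 ^+ 2)%:~R|.
  rewrite norm_Vandermonde_sqr PE (big_a (fun x => `|(pZC F * pZC Fp)^`().[x]|)).
  rewrite big_cat big_map /= derivM.
  have -> : \prod_(z <- rs) `|((pZC F)^`() * pZC Fp + pZC F * (pZC Fp)^`()).[z]|
     = `|m1%:~R| * \prod_(z <- rs) `|(pZC F).[z ^+ p]|.
    rewrite -E3' -E1 normr_prod -big_split; apply: eq_big_seq => z zrs.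
    by rewrite hornerD !hornerM rootF // mul0r addr0 normrM deriv_map.
  have -> : \prod_(z <- rs) `|((pZC F)^`() * pZC Fp + pZC F * (pZC Fp)^`()).[z ^+ p]|
     = `|m4%:~R| * \prod_(z <- rs) `|(pZC F).[z ^+ p]|.
    rewrite -E4 normr_prod -big_split; apply: eq_big_seq => z zrs.
    rewrite hornerD !hornerM rootFp // mulr0 add0r normrM mulrC deriv_map.
    by rewrite map_comp_poly map_polyXn horner_comp hornerXn.
  rewrite -normr_prod E3 -[(p ^ d)%:R ^+ 2]ger0_norm ?exprn_ge0 // -!normrM.
  by congr `|_|; rewrite !intrM rmorphXn /=; ring.
have nz : m1 * m4 * m2 ^+ 2 != 0.
  have : \det (Vandermonde n.+1 a) != 0.
    rewrite det_Vandermonde; apply/prodf_neq0 => i _; apply/prodf_neq0 => j ij.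
    rewrite subr_eq0 !mxE nth_uniq ?ss ?sn //.
    by rewrite neq_ltn ij orbT.
  by apply: contraNneq => m0; rewrite -normr_eq0 -sqrf_eq0 detE m0 normr0 mulr0.
have MaE : \prod_i max1 (a 0 i) <= (\prod_(z <- rs) max1 z) ^+ p.+1.
  rewrite (big_a (fun x => max1 x)) big_cat big_map /= exprS.
  rewrite ler_wpM2l ?prodr_ge0 // => [z _|]; first exact: max1_ge0.
  by rewrite -prodrXl; apply: ler_prod => z _; rewrite max1_ge0 max1X_le.
have := vandermonde_upper a; rewrite detE => le_up.
have -> : p%:R ^+ (2 * d) = (p ^ d)%:R ^+ 2 :> algC by rewrite mulnC exprM natrX.
rewrite sn.
apply: le_trans (le_trans le_up _).
  by rewrite ler_peMr ?exprn_ge0 // norm_int_ge1.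
rewrite ler_wpM2l ?exprn_ge0 //= [(_ * p.+1)%N]mulnC [in leRHS]exprM.
by rewrite lerXn2r ?nnegrE ?exprn_ge0 ?prodr_ge0 // => *; apply: max1_ge0.
Qed.

(** * Minimal polynomials, conjugates and their [p]-th powers *)

Local Notation pQC := (map_poly (ratr : rat -> algC)).

Definition is_minpoly (q : {poly rat}) (x : algC) : Prop :=
  q \is monic /\ forall r, root (pQC r) x = (q %| r).

Lemma minpoly_exists x : exists q, is_minpoly q x.
Proof. by have [q [_ qmon] qP] := minCpolyP x; exists q. Qed.

Lemma minpoly_root q x : is_minpoly q x -> root (pQC q) x.
Proof. by case=> _ ->; apply: dvdpp. Qed.

Lemma minpoly_size q x : is_minpoly q x -> (1 < size q)%N.
Proof.
move=> qx; rewrite -(size_map_poly (ratr : {rmorphism rat -> algC})).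
apply: (@root_size_gt1 _ x); last exact: minpoly_root.
by rewrite map_poly_eq0 monic_neq0 //; case: qx.
Qed.

(** The minimal polynomial [r] of [y] divides [q]. The cofactor is too small to vanish at [x], so
    [r] does, and [q] divides [r] in turn. *)
Lemma minpoly_conj q x y : is_minpoly q x -> root (pQC q) y -> is_minpoly q y.
Proof.
move=> qx qy; have [r [rmon rP]] := minpoly_exists y.
have [qmon qP] := qx.
have /dvdpP[h qE] : r %| q by rewrite -rP.
have h0 : h != 0.
  by apply/eqP => h0; have := monic_neq0 qmon; rewrite qE h0 mul0r eqxx.
have r1 : (1 < size r)%N by apply: (@minpoly_size r y).
have : root (pQC (h * r)) x by rewrite -qE minpoly_root.
rewrite rmorphM rootM !qP => /orP[/dvdp_leq|qr].
  rewrite h0 qE size_mul ?(monic_neq0 rmon) // => /(_ isT).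
  by case: (size r) r1 => [|[|n]] // _; rewrite addnS /= addnS ltnNge leq_addr.
suff -> : q = r by [].
apply/eqP; rewrite -eqp_monic // /eqp qr /=; by rewrite -rP.
Qed.

(** A common root of [q] and its derivative would have [q] as minimal polynomial, forcing [q] to
    divide a nonzero polynomial of smaller degree. *)
Lemma minpoly_separable q x (rs : seq algC) :
  is_minpoly q x -> pQC q = \prod_(z <- rs) ('X - z%:P) -> uniq rs.
Proof.
move=> qx qE; rewrite -separable_prod_XsubC -qE.
rewrite unlock -gcdp_eqp1 -size_poly_eq1.
apply/negPn/negP => /closed_rootP[z].
rewrite root_gcd deriv_map => /andP[qz].
have [qmon ->] := minpoly_conj qx qz.
have q1 := minpoly_size qx.
have d0 : q^`() != 0.
  apply: contraTneq (qmon) => d0; rewrite monicE lead_coefE.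
  have := congr1 (fun r : {poly rat} => r`_(size q).-2) d0; rewrite coef_deriv coef0.
  case: (size q) q1 => [|[|n]] // _ /eqP.
  by rewrite -mulr_natr mulf_eq0 pnatr_eq0 orbF => /eqP -> ; rewrite eq_sym oner_eq0.
move=> /(dvdp_leq d0); rewrite leqNgt lt_size_deriv //.
by rewrite -size_poly_gt0 ltnW.
Qed.

Lemma ratr_in_alg (L : fieldExtType rat) (LC : {rmorphism L -> algC}) :
  forall u, LC (in_alg L u) = ratr u.
Proof. by move=> u; rewrite -(fmorph_eq_rat (LC \o in_alg L)). Qed.

Lemma map_in_alg (L : fieldExtType rat) (LC : {rmorphism L -> algC}) (r : {poly rat}) :
  map_poly LC (map_poly (in_alg L) r) = pQC r.
Proof. by rewrite -map_poly_comp; apply: eq_map_poly => u; apply: ratr_in_alg. Qed.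

Lemma prime_root_of_unity p (w : algC) : prime p -> w ^+ p = 1 -> w != 1 -> p.-primitive_root w.
Proof.
move=> pr_p wp w1; have [m mw mp] := prim_order_exists (prime_gt0 pr_p) wp.
suff <- : m = p by [].
have /primeP[_ /(_ _ mp)/orP[/eqP m1|/eqP //]] := pr_p.
by case/eqP: w1; rewrite -(expr1 w) -m1 prim_expr_order.
Qed.

(* Otherwise the constant term of the minimal polynomial of [x] over [Q(x^p)] is, up to
   sign, [w x^r] with [1 < r < p] and [w^p = 1].  The degree of [Q(x)] is less than
   [p - 1], so [w = 1], and then [x^r] and [x^p] generate [x]. *)
Lemma minpoly_pow_generates q x p :
  is_minpoly q x -> x != 0 -> prime p -> (size q < p)%N ->
  exists T : {poly rat}, (pQC T).[x ^+ p] = x.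
Proof.
move=> qx x0 pr_p ltqp.
have [L [LC [s1 s1E s1full]]] := num_field_exists [:: x].
case: s1 s1E s1full => [|a [|//]] //= [ax].
rewrite adjoin_seq1 => afull.
have a0 : a != 0 by rewrite -(fmorph_eq0 LC) ax.
have degree_le (U : {subfield L}) y : (adjoin_degree U y <= \dim {: L})%N.
  rewrite (leq_trans _ (dimvS (subvf <<U; y>>%VS))) // dim_Fadjoin.
  by rewrite leq_pmulr // adim_gt0.
have dimL : (\dim {: L} < size q)%N.
  rewrite -afull dim_Fadjoin dimv1 muln1 -size_minPoly.
  rewrite -(size_map_poly (in_alg L)); apply: dvdp_leq.
    by rewrite map_poly_eq0 monic_neq0 //; case: qx.
  apply: minPoly_dvdp; first by apply/polyOver1P; exists q.
  by rewrite -(fmorph_root LC) map_in_alg ax minpoly_root.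
pose K := <<1; a ^+ p>>%AS.
pose r := adjoin_degree K a.
have rdimL : (r <= \dim {: L})%N by apply: degree_le.
have r_gt0 : (0 < r)%N by [].
have apK : a ^+ p \in K by apply: memv_adjoin.
suff aK : a \in K.
  have := Fadjoin_poly_eq aK; have /polyOver1P[T ->] := Fadjoin_polyOver 1%AS (a ^+ p) a.
  move=> /(congr1 LC) h; exists T; by rewrite -[X in _ = X]ax -h -horner_map map_in_alg rmorphXn /= ax.
have LCap : LC (a ^+ p) = x ^+ p by rewrite rmorphXn /= ax.
have [zs mE] := closed_field_poly_normal (map_poly LC (minPoly K a)).
rewrite lead_coef_map (monicP (monic_minPoly _ _)) rmorph1 scale1r in mE.
have szs : size zs = r.
  by apply: succn_inj; rewrite -(size_prod_XsubC zs id) -mE size_map_poly size_minPoly.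
have zsP z : z \in zs -> z ^+ p = x ^+ p.
  rewrite -root_prod_XsubC -mE => rz.
  have : minPoly K a %| 'X^p - (a ^+ p)%:P.
    apply: minPoly_dvdp; last by rewrite rootE !hornerE subrr.
    by rewrite rpredB ?rpredX ?polyOverX // polyOverC.
  rewrite -(dvdp_map LC) => /dvdpP[h hE].
  have : root (map_poly LC ('X^p - (a ^+ p)%:P)) z by rewrite hE rootM rz orbT.
  by rewrite rmorphB /= map_polyXn map_polyC /= LCap rootE !hornerE subr_eq0 => /eqP.
(* The norm of [a] over [K]. Its image is the product of the [zs], all with [p]-th power [x^p], so
   [b / a^r] is a [p]-th root of unity. *)
pose b := (-1) ^+ r * (minPoly K a)`_0.
have bK : b \in K.
  by rewrite rpredM ?rpredX ?rpredN ?rpred1 //; apply/polyOverP/minPolyOver.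
have bE : LC b = \prod_(z <- zs) z.
  rewrite /b rmorphM /= rmorph_sign -coef_map mE coef0_prod_XsubC szs.
  by rewrite mulrA -exprMn mulrNN mulr1 expr1n mul1r.
pose w := b / a ^+ r.
have wp : LC w ^+ p = 1.
  rewrite /w rmorphM fmorphV /= [LC (a ^+ r)]rmorphXn /= bE ax exprMn exprVn -prodrXl.
  rewrite (eq_big_seq (fun _ => x ^+ p)) // prodr_const_seq szs -!exprM mulnC divff //.
  by rewrite expf_neq0.
have [w1|w1] := eqVneq w 1.
  have arK : a ^+ r \in K.
    suff -> : a ^+ r = b by [].
    have := congr1 (fun y => y * a ^+ r) w1; rewrite mul1r /w divfK ?expf_neq0 //.
  have : coprime r p.
    rewrite coprime_sym prime_coprime // gtnNdvd //.
    by rewrite (leq_ltn_trans rdimL) // (ltn_trans dimL).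
  case/(coprimeP _ r_gt0) => -[u v] /= uv.
  have aE : a = (a ^+ r) ^+ u / (a ^+ p) ^+ v.
    rewrite -!exprM ![(_ * u)%N]mulnC ![(_ * v)%N]mulnC.
    have -> : (u * r = v * p + 1)%N by lia.
    by rewrite exprD expr1 mulrAC divff ?mul1r // expf_neq0.
  rewrite [X in X \in _]aE; apply: memvM; [exact: (rpredX u arK) | rewrite memvV; exact: (rpredX v apK)].
have := minCpoly_cyclotomic (prime_root_of_unity pr_p wp _).
rewrite fmorph_eq1 => /(_ w1) mw.
have /polyOver1P[M ME] := minPolyOver 1%AS w.
have Mw : root (pQC M) (LC w) by rewrite -(map_in_alg LC) -ME fmorph_root root_minPoly.
have [c [cE cmon] cP] := minCpolyP (LC w).
rewrite cP in Mw.
have : (size c <= size M)%N.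
  apply: dvdp_leq Mw; rewrite -(map_poly_eq0 (in_alg L)) -ME monic_neq0 ?monic_minPoly //.
rewrite -(size_map_poly (ratr : {rmorphism rat -> algC})) -cE mw size_cyclotomic totient_prime //.
rewrite prednK ?prime_gt0 // -(size_map_poly (in_alg L)) -ME size_minPoly => le_p.
have := degree_le 1%AS w.
by move=> le2; have := leq_ltn_trans (leq_trans le_p _) ltqp; rewrite ltnn => /(_ (leq_ltn_trans le2 dimL)).
Qed.

Lemma expr_inj_not_root_of_unity (x : algC) (i j : nat) :
  x != 0 -> (forall m, (0 < m)%N -> x ^+ m != 1) -> x ^+ i = x ^+ j -> i = j.
Proof.
move=> x0 xn1; wlog le_ij : i j / (i <= j)%N => [hw|].
  by case/orP: (leq_total i j) => h E; [|apply/esym]; apply: hw.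
rewrite -{1}(subnK le_ij) addnC exprD -[in LHS](mulr1 (x ^+ i)) => E.
have {}E : 1 = x ^+ (j - i) by apply: (mulfI (expf_neq0 i x0)).
have [lt|//] := ltnP 0 (j - i); last by rewrite leqn0 subn_eq0 => ge; apply/eqP; rewrite eqn_leq le_ij.
by have := xn1 _ lt; rewrite -E eqxx.
Qed.

(** On the conjugates [z -> z^p] is inverted by [T], hence injective. If some [z^p] were a
    conjugate, the finite set of conjugates would be stable under [p]-th powers, two of the
    [x^(p^k)] would coincide, and [x] would be a root of unity. *)
Lemma uniq_roots_pow q x (rs : seq algC) p :
  is_minpoly q x -> pQC q = \prod_(z <- rs) ('X - z%:P) -> x != 0 ->
  (forall m, (0 < m)%N -> x ^+ m != 1) -> prime p -> (size q < p)%N ->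
  uniq (rs ++ [seq z ^+ p | z <- rs]).
Proof.
move=> qx qE x0 xn1 pr_p ltqp.
have rootq z : root (pQC q) z = (z \in rs) by rewrite qE root_prod_XsubC.
have dvd_root r z : q %| r -> z \in rs -> root (pQC r) z.
  by move=> qr; rewrite -rootq => /(minpoly_conj qx)[_ ->].
have xrs : x \in rs by rewrite -rootq minpoly_root.
have [T Tx] := minpoly_pow_generates qx x0 pr_p ltqp.
have TP z : z \in rs -> (pQC T).[z ^+ p] = z.
  move=> zrs; have : root (pQC (T \Po 'X^p - 'X)) z.
    apply: dvd_root zrs; case: (qx) => _ <-.
    by rewrite rmorphB /= map_comp_poly map_polyXn map_polyX rootE !hornerE horner_comp hornerXn Tx subrr.
  rewrite rmorphB /= map_comp_poly map_polyXn map_polyX rootE !hornerE horner_comp hornerXn.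
  by rewrite subr_eq0 => /eqP.
have us := minpoly_separable qx qE.
rewrite cat_uniq us /= andbC; apply/andP; split.
  by rewrite map_inj_in_uniq // => y z /TP yE /TP zE yz; rewrite -yE yz zE.
apply/hasPn => _ /mapP[z zrs ->]; apply/negP => zprs.
have pow_rs y : y \in rs -> y ^+ p \in rs.
  move=> yrs; have : root (pQC (q \Po 'X^p)) y.
    apply: dvd_root yrs; move: zrs; rewrite -rootq => /(minpoly_conj qx)[_ <-].
    by rewrite map_comp_poly map_polyXn rootE horner_comp hornerXn -rootE rootq.
  by rewrite map_comp_poly map_polyXn rootE horner_comp hornerXn -rootE rootq.
have xpk k : x ^+ (p ^ k) \in rs.
  by elim: k => [|k IH]; rewrite ?expr1 // expnSr exprM pow_rs.
pose t := [seq x ^+ (p ^ k) | k <- iota 0 (size rs).+1].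
have : (size t <= size rs)%N.
  apply: uniq_leq_size => [|_ /mapP[k _ ->] //].
  rewrite map_inj_uniq ?iota_uniq // => i j /(expr_inj_not_root_of_unity x0 xn1).
  by move/eqP; rewrite eqn_exp2l ?prime_gt1 // => /eqP.
by rewrite size_map size_iota ltnn.
Qed.

(* Multiplication by [g] preserves the lattice spanned by [1, x, ..., x^n] for large [n]. *)
Lemma Aint_between (P Q : {poly int}) (x g : algC) k :
  (pZC P).[x] = g -> g * x ^+ k = (pZC Q).[x] -> (size Q <= k.+1)%N -> g \in Aint.
Proof.
move=> Px Qx sQ; set n := (k + size P)%N.
pose r i : {poly int} := if (i < k)%N then P * 'X^i else Q * 'X^(i - k).
have szr i : (i < n.+1)%N -> (size (r i) <= n.+1)%N.
  rewrite /r /n => lt_i; case: ltnP => ik.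
    by rewrite (leq_trans (size_mul_leq _ _)) // size_polyXn; lia.
  by rewrite (leq_trans (size_mul_leq _ _)) // size_polyXn; lia.
have rx i : (pZC (r i)).[x] = g * x ^+ i.
  rewrite /r; case: ltnP => ik; rewrite rmorphM /= map_polyXn hornerM hornerXn ?Px //.
  by rewrite -Qx -mulrA -exprD subnKC.
pose A : 'M[int]_n.+1 := \matrix_(i, j) (r j)`_i.
apply: (@root_monic_Aint (pZC (char_poly A))).
- rewrite map_char_poly -eigenvalue_root_char; apply/eigenvalueP.
  exists (\row_i x ^+ i); last first.
    by apply/eqP => /rowP/(_ ord0); rewrite !mxE expr0 => /eqP; rewrite oner_eq0.
  apply/rowP => j; rewrite !mxE -rx.
  rewrite (@horner_coef_wide _ n.+1); last by rewrite (leq_trans (size_poly _ _)) // szr.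
  by apply: eq_bigr => i _; rewrite !mxE coef_map mulrC.
- by rewrite monic_map // char_poly_monic.
- by apply/polyOverP => i; rewrite coef_map /= intr_int.
Qed.

(** * Gaps and the Mahler measure *)

Lemma pZC_pQC (P : {poly int}) : pZC P = pQC (map_poly intr P).
Proof. by rewrite -map_poly_comp; apply: eq_map_poly => i /=; rewrite ratr_int. Qed.

Lemma size_pZC (P : {poly int}) : size (pZC P) = size P.
Proof. by apply: size_map_inj_poly => //; apply: intr_inj. Qed.

Lemma norm_intr_absz (m : int) : `|m%:~R : algC| = (absz m)%:R.
Proof. by rewrite -intr_norm natr_absz. Qed.

Definition l1norm (P : {poly int}) : nat := (\sum_(i < size P) absz (P`_i)%R)%N.

Lemma norm_horner_le (P : {poly int}) (z : algC) n : (size P <= n.+1)%N ->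
  `|(pZC P).[z]| <= (l1norm P)%:R * max1 z ^+ n.
Proof.
move=> sP; rewrite horner_coef (le_trans (ler_norm_sum _ _ _)) //.
rewrite size_pZC natr_sum mulr_suml; apply: ler_sum => i _.
rewrite coef_map normrM normrX /= norm_intr_absz ler_wpM2l //.
apply: (@le_trans _ _ (max1 z ^+ i)).
  by rewrite lerXn2r ?nnegrE ?max1_ge0 ?max1_ge_norm.
by rewrite ler_weXn2l ?max1_ge1 // -ltnS (leq_trans (ltn_ord i)).
Qed.

(** The gap makes [b z * z^i] an algebraic integer for [i <= u]. This yields [|a|^u <= |N(b)|], with
    [N(b)] the product of the [b z], and each [|b z| max1(z)^u] is at most [C]. *)
Lemma gap_mahler (F H0 H1 : {poly int}) q x (rs : seq algC) k u C :
  is_minpoly q x -> pQC q = \prod_(z <- rs) ('X - z%:P) ->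
  pZC F = (lead_coef F)%:~R *: pQC q -> zcontents F = 1 ->
  (u <= k)%N -> (size H0 <= (k - u).+1)%N ->
  (pZC (H0 + 'X^k * H1)).[x] = 0 -> (pZC H1).[x] != 0 ->
  (l1norm H0 <= C)%N -> (l1norm H1 <= C)%N ->
  (`|(lead_coef F)%:~R| * \prod_(z <- rs) max1 z) ^+ u <= C%:R ^+ size rs.
Proof.
move=> qx qE FE cF le_uk sH0 Hx H1x C0 C1.
set a := lead_coef F.
pose b z := (pZC H1).[z].
have ZQC := pZC_pQC.
have Hz z : z \in rs -> (pZC H0).[z] + z ^+ k * b z = 0 /\ b z != 0.
  rewrite -root_prod_XsubC -qE => /(minpoly_conj qx)[_ zP]; split.
    have /eqP : root (pZC (H0 + 'X^k * H1)) z.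
      by rewrite ZQC zP; case: qx => _ <-; rewrite -ZQC rootE Hx.
    by rewrite rmorphD rmorphM /= map_polyXn !hornerE.
  by move: H1x; rewrite /b -!rootE ZQC zP; case: qx => _ ->.
have bAint z j : z \in rs -> (j <= u)%N -> b z * z ^+ j \in Aint.
  move=> /Hz[hz _] ju; apply: (@Aint_between (H1 * 'X^j) (- H0) z _ (k - j)).
  - by rewrite rmorphM /= map_polyXn hornerM hornerXn.
  - rewrite -mulrA -exprD subnKC ?(leq_trans ju) // rmorphN hornerN mulrC.
    by apply/eqP; rewrite -addr_eq0 addrC hz.
  - by rewrite size_polyN (leq_trans sH0) // ltnS leq_sub2l.
(* [W] is integral, and it is also a rational multiple of the [u]-th power of the
   primitive polynomial [F], so Gauss' lemma applies. *)
pose W := \prod_(z <- rs) (b z *: ('X - z%:P) ^+ u).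
have [N NE] : exists N : rat, \prod_(z <- rs) b z = ratr N.
  have [qmon _] := qx.
  have [N NE] := prod_roots_image (map_poly intr H1) qmon qE.
  by exists N; rewrite -NE; apply: eq_bigr => z _; rewrite -ZQC.
have WE : W = ratr N *: pQC q ^+ u.
  by rewrite /W scaler_prod NE prodrXl qE.
have WA : W \is a polyOver Aint.
  rewrite /W big_seq; apply: rpred_prod => z zrs.
  rewrite exprBn scaler_sumr; apply: rpred_sum => i _.
  rewrite -scalerMnr rpredMn //.
  have -> : b z *: ((-1) ^+ i * 'X^(u - i) * z%:P ^+ i)
          = (-1) ^+ i * 'X^(u - i) * (b z * z ^+ i)%:P.
    by rewrite -mul_polyC polyCM rmorphXn /=; ring.
  have bz : b z * z ^+ i \in Aint by rewrite bAint // -ltnS.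
  by rewrite !rpredM ?rpredX ?rpredN ?rpred1 ?polyOverX ?polyOverC.
have WZ : W \is a polyOver Num.int.
  apply/polyOverP => i; apply: Cint_rat_Aint; last exact: (polyOverP WA).
  by rewrite WE -rmorphXn /= coefZ coef_map /= rpredM // Crat_rat.
have [Wz WzE] := floorpP WZ.
have [qmon _] := qx.
have NWz : ratr N = (lead_coef Wz)%:~R :> algC.
  have lq : lead_coef (pQC q ^+ u) = 1 by apply/monicP; rewrite monic_exp ?monic_map.
  have := congr1 lead_coef WE; rewrite lead_coefZ lq mulr1 => <-.
  by rewrite WzE lead_coef_map_inj //; apply: intr_inj.
have key : a ^+ u *: Wz = lead_coef Wz *: F ^+ u.
  apply: (@map_inj_poly _ _ (intr : int -> algC)) => //; first exact: intr_inj.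
  rewrite !map_polyZ /= -WzE WE rmorphXn /= rmorphXn /= FE NWz exprZn !scalerA.
  by rewrite mulrC.
have N0 : lead_coef Wz != 0.
  rewrite -(intr_eq0 algC) -NWz -NE prodf_seq_neq0; apply/allP => z /Hz[] //.
(* Contents in [key]: [F^u] is primitive, so [a^u] divides the leading coefficient of [Wz], which is
   the product of the [b z]. *)
have le_aN : `|(lead_coef F)%:~R| ^+ u <= `|\prod_(z <- rs) b z|.
  rewrite NE NWz -!intr_norm -rmorphXn /= ler_int.
  have zcX m : zcontents (F ^+ m) = 1.
    elim: m => [|m IH]; first by rewrite expr0 zcontents_monic ?monic1.
    by rewrite exprS zcontentsM IH cF.
  have := congr1 zcontents key; rewrite !zcontentsZ zcX mulr1 => lWz.
  rewrite -lWz normrM normrX ler_peMr ?exprn_ge0 // -gtz0_ge1 normr_gt0.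
  by apply: contraNneq N0 => c0; rewrite -lWz c0 mulr0.
rewrite exprMn -prodrXl.
apply: (@le_trans _ _ (\prod_(z <- rs) (`|b z| * max1 z ^+ u))).
  by rewrite big_split /= -normr_prod ler_wpM2r // prodr_ge0 // => z _; rewrite exprn_ge0 ?max1_ge0.
rewrite -prodr_const_seq.
rewrite big_seq [leRHS]big_seq; apply: ler_prod => z zrs.
rewrite mulr_ge0 ?exprn_ge0 ?max1_ge0 //=.
have [hz bz] := Hz z zrs.
have leC (P : {poly int}) : (l1norm P <= C)%N -> (l1norm P)%:R <= C%:R :> algC by rewrite ler_nat.
(* In the closed unit disc [H1] is bounded directly. Outside, [z^k H1(z) = -H0(z)], and the degree
   bound [k - u] on [H0] gains the factor [|z|^u]. *)
case: max1P (norm_horner_le z sH0) (norm_horner_le z (leqnSn (size H1))) => zl.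
  by rewrite !expr1n !mulr1 => _ h; apply: le_trans h (leC _ C1).
move=> h _.
have z0 : 0 < `|z| by apply: lt_trans zl.
rewrite -(ler_pM2r (exprn_gt0 (k - u) z0)) -mulrA -exprD subnKC //.
apply: le_trans (_ : _ <= (l1norm H0)%:R * `|z| ^+ (k - u)) _; last first.
  by rewrite ler_wpM2r ?leC // exprn_ge0.
apply: le_trans h; rewrite mulrC -normrX -normrM.
by move/eqP: hz; rewrite addr_eq0 => /eqP ->; rewrite normrN.
Qed.

Lemma primitive_multiple (q : {poly rat}) : q \is monic ->
  exists F : {poly int}, zcontents F = 1 /\ pZC F = (lead_coef F)%:~R *: pQC q.
Proof.
move=> qmon; have [P [a a0 qE]] := rat_poly_scale q.
have P0 : P != 0 by apply: contraTneq (monic_neq0 qmon) => P0; rewrite qE P0 rmorph0 scaler0 eqxx.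
exists (zprimitive P); split; first by rewrite zcontents_primitive P0.
have [c [c0 FE]] : exists c : rat, c != 0 /\ map_poly intr (zprimitive P) = c *: q.
  exists (a%:~R / (zcontents P)%:~R); rewrite mulf_neq0 ?invr_eq0 ?intr_eq0 ?zcontents_eq0 //; split=> //.
  have zc0 : (zcontents P)%:~R != 0 :> rat by rewrite intr_eq0 zcontents_eq0.
  have a0' : a%:~R != 0 :> rat by rewrite intr_eq0.
  move: (zcontents P) (zprimitive P) (zpolyEprim P) zc0 => b Z PE b0.
  rewrite qE PE map_polyZ /= !scalerA.
  by rewrite [X in X *: _](_ : _ = 1) ?scale1r //; field; rewrite b0 a0'.
rewrite pZC_pQC.
have cE : c = (lead_coef (zprimitive P))%:~R.
  have := congr1 lead_coef FE; rewrite lead_coefZ (monicP qmon) mulr1 => <-.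
  by rewrite lead_coef_map_inj //; apply: intr_inj.
by rewrite FE map_polyZ /= cE ratr_int.
Qed.

(** Eliminates the Mahler measure [M] of [q]: the Vandermonde bound is raised to the power [u],
    [M^u <= C^d] is inserted, and a [2d]-th root is taken. Here [d] is the degree of [q]. *)
Lemma gap_nat q x (H0 H1 : {poly int}) (k u p C d : nat) :
  is_minpoly q x -> x != 0 -> (forall m, (0 < m)%N -> x ^+ m != 1) ->
  (u <= k)%N -> (size H0 <= (k - u).+1)%N ->
  (pZC (H0 + 'X^k * H1)).[x] = 0 -> (pZC H1).[x] != 0 ->
  (l1norm H0 <= C)%N -> (l1norm H1 <= C)%N ->
  prime p -> (size q < p)%N ->
  d = (size q).-1 ->
  (p ^ u <= (2 * d) ^ u * C ^ ((2 * d).-1 * p.+1))%N.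
Proof.
move=> qx x0 xn1 le_uk sH0 Hx H1x C0 C1 pr_p ltqp dE.
have [qmon _] := qx.
have [rs qE] := closed_field_poly_normal (pQC q).
rewrite (monicP _) ?monic_map // scale1r in qE.
have srs : size rs = d.
  have := size_prod_XsubC rs id; by rewrite -qE size_map_poly dE => ->.
have d_gt0 : (0 < d)%N by rewrite dE -subn1 subn_gt0 (minpoly_size qx).
have [F [cF FE]] := primitive_multiple qmon.
have := gap_mahler qx qE FE cF le_uk sH0 Hx H1x C0 C1; rewrite srs.
set a := lead_coef F; set M := \prod_(z <- rs) _ => leM.
have M1 : 1 <= M.
  rewrite /M; elim: (rs) => [|z s IH]; first by rewrite big_nil.
  by rewrite big_cons mulr_ege1 // max1_ge1.
have M0 : 0 <= M by apply: le_trans M1.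
have a0 : a != 0.
  rewrite lead_coef_eq0; apply/eqP => F0; by rewrite F0 zcontents0 in cF.
have a1 : 1 <= `|a%:~R : algC| by apply: norm_int_ge1.
have Cd0 : (0 < C)%N.
  rewrite lt0n; apply/eqP => C00; move: leM; rewrite C00 expr0n eqn0Ngt d_gt0.
  have pos : 0 < (`|a%:~R : algC| * M) ^+ u.
    by rewrite exprn_gt0 // mulr_gt0 // (lt_le_trans ltr01).
  by move/(lt_le_trans pos); rewrite ltxx.
have p0 := prime_gt0 pr_p.
(* If [q] is not integral, then [M(q) >= |a| >= 2] replaces the Vandermonde bound. *)
have [a2|a2] := leqP 2 (absz a).
  have le2 : (2 ^ u <= C ^ d)%N.
    rewrite -(ler_nat algC) !natrX (le_trans _ leM) // lerXn2r ?nnegrE ?mulr_ge0 //.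
    by rewrite norm_intr_absz (@le_trans _ _ (absz a)%:R) ?ler_nat // ler_peMr.
  have le_dp : (p ^ u <= (C ^ d) ^ p)%N.
    apply: leq_trans (_ : (2 ^ u) ^ p <= _)%N; last by rewrite leq_exp2r.
    by rewrite -expnM mulnC expnM; case: (u) => // v; rewrite leq_exp2r // ltnW // ltn_expl.
  rewrite (leq_trans le_dp) // -expnM (leq_trans _ (leq_pmull _ _)) ?expn_gt0 ?muln_gt0 ?d_gt0 //.
  rewrite leq_pexp2l // leq_mul //.
  by rewrite -ltnS prednK ?muln_gt0 // mul2n -addnn -[X in (X < _)%N]addn0 ltn_add2l.
(* Now [a] is 1 or -1, so [q] itself has integer coefficients. *)
have a1E : a * a = 1.
  have : absz a = 1%N by apply/eqP; rewrite eqn_leq -ltnS a2 absz_gt0.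
  by case: (a) => [m /= ->|m /= [->]].
pose Fm := a *: F.
have Fmon : Fm \is monic by rewrite monicE lead_coefZ a1E.
have FmE : pZC Fm = \prod_(z <- rs) ('X - z%:P).
  by rewrite /Fm map_polyZ /= FE scalerA -intrM a1E scale1r qE.
have rs0 : (0 < size rs)%N by rewrite srs.
have := mahler_lower Fmon FmE rs0 pr_p (uniq_roots_pow qx qE x0 xn1 pr_p ltqp).
rewrite srs -/M => leP.
have {}leM : M ^+ u <= C%:R ^+ d.
  by apply: le_trans leM; rewrite lerXn2r ?nnegrE ?mulr_ge0 // ler_peMl.
have d20 : (0 < 2 * d)%N by rewrite muln_gt0.
rewrite -(leq_exp2r _ _ d20) -(ler_nat algC).
have -> : ((p ^ u) ^ (2 * d))%:R = (p%:R ^+ (2 * d)) ^+ u :> algC.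
  by rewrite !natrX -!exprM mulnC.
have -> : (((2 * d) ^ u * C ^ ((2 * d).-1 * p.+1)) ^ (2 * d))%:R
  = ((2 * d)%:R ^+ (2 * d)) ^+ u * C%:R ^+ ((2 * d).-1 * p.+1 * (2 * d)) :> algC.
  by rewrite expnMn natrM !natrX -!exprM [(u * _)%N]mulnC.
apply: (@le_trans _ _ (((2 * d)%:R ^+ (2 * d) * M ^+ (2 * (2 * d).-1 * p.+1)) ^+ u)).
  by rewrite lerXn2r ?nnegrE ?mulr_ge0 ?exprn_ge0.
rewrite exprMn ler_wpM2l ?exprn_ge0 //.
rewrite -exprM mulnC exprM.
apply: (@le_trans _ _ ((C%:R ^+ d) ^+ (2 * (2 * d).-1 * p.+1))).
  by rewrite lerXn2r ?nnegrE ?exprn_ge0.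
rewrite -!exprM.
rewrite (_ : (d * (2 * (2 * d).-1 * p.+1) = (2 * d).-1 * p.+1 * (2 * d))%N) //.
by lia.
Qed.

(** * Multiplicities and gaps *)

Lemma dvdp_mup (F : closedFieldType) (P Q : {poly F}) :
  P != 0 -> Q != 0 -> (forall x, (mup x P <= mup x Q)%N) -> P %| Q.
Proof.
move=> P0 Q0 le_mup'; have [rs PE] := closed_field_poly_normal P.
rewrite PE dvdpZl ?lead_coef_eq0 //.
have mupE x : mup x P = mup x (\prod_(z <- rs) ('X - z%:P)).
  rewrite {1}PE -mul_polyC mupMr // rootC lead_coef_eq0 //.
have le_mup x : (mup x (\prod_(z <- rs) ('X - z%:P)%R) <= mup x Q)%N by rewrite -mupE.
elim: rs Q Q0 le_mup {PE mupE le_mup'} => [|z rs IH] Q Q0 le_mup; first by rewrite big_nil dvd1p.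
have P1 : \prod_(z <- rs) ('X - z%:P) != 0 by rewrite monic_neq0 // monic_prod_XsubC.
have zQ : 'X - z%:P %| Q.
  rewrite -['X - _]expr1 -mup_geq // (leq_trans _ (le_mup z)) //.
  by rewrite big_cons mupM ?polyXsubC_eq0 // -['X - _]expr1 mup_XsubCX eqxx.
case/dvdpP: zQ Q0 le_mup => R -> ; rewrite mulf_eq0 negb_or => /andP[R0 X0] le_mup.
rewrite big_cons mulrC dvdp_mul2r // IH // => x.
by have := le_mup x; rewrite big_cons mulrC !mupM // leq_add2r.
Qed.

Lemma not_dvdp_mup (F : closedFieldType) (P Q : {poly F}) : P != 0 ->
  ~~ (P %| Q) -> exists x, Q != 0 /\ (mup x Q < mup x P)%N.
Proof.
move=> P0 ndvd; have Q0 : Q != 0 by apply: contraNneq ndvd => ->; rewrite dvdp0.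
have [rs PE] := closed_field_poly_normal P.
have [/hasP[x _ lt_x]|/hasPn no] := boolP (has (fun x => mup x Q < mup x P)%N rs).
  by exists x.
case/negP: ndvd; apply: dvdp_mup => // x.
have [xrs|xrs] := boolP (x \in rs); first by rewrite leqNgt no.
rewrite mupNroot //; apply: contra xrs => xP.
by move: xP; rewrite PE rootZ ?lead_coef_eq0 // root_prod_XsubC.
Qed.

(** The Euler operator. It scales the coefficient of [X^i] by [i], so unlike the derivative it
    shifts no exponent and preserves gaps. *)
Definition theta (R : nzRingType) (P : {poly R}) := 'X * P^`().

Lemma coef_iter_theta (R : nzRingType) (P : {poly R}) l i :
  (iter l (@theta R) P)`_i = P`_i *+ (i ^ l).
Proof.
elim: l => [|l IH] //=; rewrite /theta coefXM.
case: i IH => [|i] IH; first by rewrite /= exp0n // mulr0n.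
by rewrite /= coef_deriv IH -mulrnA -expnSr.
Qed.

Lemma map_iter_theta (R S : nzRingType) (f : {rmorphism R -> S}) (P : {poly R}) l :
  map_poly f (iter l (@theta R) P) = iter l (@theta S) (map_poly f P).
Proof. by apply/polyP => i; rewrite coef_map !coef_iter_theta coef_map raddfMn. Qed.

Lemma mup_deriv (F : numFieldType) (P : {poly F}) x : P != 0 -> root P x ->
  mup x P = (mup x P^`()).+1 /\ P^`() != 0.
Proof.
move=> P0 rx; have [m [Q Qx PE]] := multiplicity_XsubC P x.
move: rx; rewrite PE; rewrite P0 /= in Qx; case: m PE => [|m] PE.
  by rewrite mulr1 (negPf Qx).
move=> _; have Q0 : Q != 0 by apply: contraNneq Qx => ->; rewrite root0.
have X0 k : ('X - x%:P) ^+ k != 0 :> {poly F} by rewrite expf_neq0 // polyXsubC_eq0.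
pose R := Q^`() * ('X - x%:P) + Q *+ m.+1.
have Rx : ~~ root R x.
  rewrite rootE /R hornerD hornerM hornerXsubC subrr mulr0 add0r hornerMn.
  by rewrite -mulr_natr mulf_neq0 ?pnatr_eq0.
have R0 : R != 0 by apply: contraNneq Rx => ->; rewrite root0.
have -> : (Q * ('X - x%:P) ^+ m.+1)^`() = R * ('X - x%:P) ^+ m.
  rewrite derivM deriv_exp derivXsubC mul1r /R /=.
  by rewrite [RHS]mulrDl -mulrA exprS mulrnAl mulrnAr.
rewrite mulf_neq0 // !mupM // !mup_XsubCX eqxx (mupNroot Qx) (mupNroot Rx).
by [].
Qed.

Lemma root_iter_theta (F : numFieldType) (P : {poly F}) x m l :
  ('X - x%:P) ^+ m %| P -> (l < m)%N -> root (iter l (@theta F) P) x.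
Proof.
elim: l m P => [|l IH] [|m] P // /dvdpP[Q ->] lt_lm.
  by rewrite exprS mulrCA rootE /= hornerM hornerXsubC subrr mul0r.
rewrite iterSr; apply: (IH m) => //.
rewrite /theta derivM deriv_exp derivXsubC mul1r /= dvdp_mull //; apply: dvdp_add.
  by rewrite exprS mulrA dvdp_mulIr.
by rewrite -mulr_natr mulrA mulrAC dvdp_mulIr.
Qed.

(** At a nonzero root [theta] lowers the multiplicity by exactly one, since [X] does not vanish
    there. *)
Lemma dvdp_iter_theta (F : numFieldType) (P : {poly F}) x m : x != 0 ->
  (forall l, (l < m)%N -> root (iter l (@theta F) P) x) -> ('X - x%:P) ^+ m %| P.
Proof.
move=> x0; have [-> _|] := eqVneq P 0; first exact: dvdp0.
elim: m P => [|m IH] P P0 roots; first by rewrite expr0 dvd1p.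
have [mE d0] := mup_deriv P0 (roots 0 isT).
rewrite -mup_geq // mE ltnS.
have X0 : ~~ root ('X : {poly F}) x by rewrite rootX.
rewrite -(mupMr _ X0) mup_geq ?mulf_neq0 ?polyX_eq0 //.
apply: IH => [|l lt_lm]; first by rewrite mulf_neq0 ?polyX_eq0.
by rewrite -[_ * _]/(theta P) -iterSr; apply: roots.
Qed.

(** [x] is a simple root of the separable [q], so each unit of multiplicity costs a factor [q] of
    [f]. This trades multiplicity against the degree of [x]. *)
Lemma mup_minpoly q x (f : {poly rat}) : is_minpoly q x -> f != 0 ->
  (mup x (pQC f) * (size q).-1 <= (size f).-1)%N.
Proof.
move=> qx; have [qmon qP] := qx; have q1 := minpoly_size qx.
have [rs qE] := closed_field_poly_normal (pQC q).
rewrite (monicP _) ?monic_map // scale1r in qE.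
have us := minpoly_separable qx qE.
have q0 : pQC q != 0 by rewrite map_poly_eq0 monic_neq0.
have mq : (mup x (pQC q) <= 1)%N.
  rewrite mup_leq // qE.
  have xrs : x \in rs by rewrite -root_prod_XsubC -qE minpoly_root.
  rewrite (perm_big _ (perm_to_rem xrs)) big_cons expr2 dvdp_mul2l ?polyXsubC_eq0 //.
  by rewrite dvdp_XsubCl root_prod_XsubC mem_rem_uniq // !inE eqxx.
have [n] := ubnP (size f); elim: n f => // n IH f; rewrite ltnS => szf f0.
have [rx|nrx] := boolP (root (pQC f) x); last by rewrite mupNroot.
move: rx f0 szf; rewrite qP => /dvdpP[h ->]; rewrite mulf_eq0 negb_or => /andP[h0 _] szf.
have qn0 := monic_neq0 qmon.
rewrite rmorphM /= mupM ?map_poly_eq0 // mulnDl.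
move: szf; rewrite size_mul // => szf.
have szh : (0 < size h)%N by rewrite size_poly_gt0.
have /IH/(_ h0) : (size h < n)%N.
  by move: szf q1 szh; move: (size h) (size q) => a b; lia.
move=> le_h.
apply: leq_trans (leq_add le_h (leq_mul mq (leqnn _))) _.
by rewrite mul1n; move: (size h) (size q) szh q1 => a b; lia.
Qed.

(** Pigeonhole: [S] cuts the interval up to [m] into as many gaps as it has points below [m]. The
    induction removes the last gap and keeps the longer of it and the one found before. *)
Lemma pick_gap (S : pred nat) m : S 0 -> S m -> (0 < m)%N ->
  exists e k, [/\ (e < k <= m)%N, S e, S k, (forall i, (e < i < k)%N -> ~~ S i)
    & (m <= (\sum_(i < m) S i) * (k - e))%N].
Proof.
move=> S0; have [n] := ubnP m; elim: n m => // n IH m; rewrite ltnS => le_mn Sm m0.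
have ex : exists e, S e && (e < m)%N by exists 0; rewrite S0.
have ub e : S e && (e < m)%N -> (e <= m)%N by case/andP => _ /ltnW.
case: (ex_maxnP ex ub) => e /andP[Se lt_em] emax.
have between i : (e < i < m)%N -> ~~ S i.
  by case/andP => ei im; apply: contraL ei => Si; rewrite -leqNgt emax // Si.
have sum_le : ((\sum_(i < e) S i).+1 <= \sum_(i < m) S i)%N.
  rewrite -!(big_mkord xpredT (fun i => nat_of_bool (S i))).
  rewrite [X in (_ < X)%N](@big_cat_nat _ _ _ e) ?(ltnW lt_em) //=.
  by rewrite (big_ltn lt_em) Se; lia.
have [e0|e0] := posnP e.
  rewrite {}e0 in between sum_le *; exists 0, m; split=> //; first by rewrite m0 leqnn.
  by rewrite subn0 leq_pmull // (leq_trans _ sum_le).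
have [e1 [k1 [/andP[ek1 ke] Se1 Sk1 btw1 le_e]]] := IH e (leq_trans lt_em le_mn) Se e0.
have [le_g|lt_g] := leqP (k1 - e1) (m - e).
  exists e, m; split=> //; first by rewrite lt_em leqnn.
  rewrite (leq_trans _ (leq_mul sum_le (leqnn _))) // mulSn.
  rewrite -[X in (X <= _)%N](subnK (ltnW lt_em)) leq_add2l (leq_trans le_e) //.
  by rewrite leq_mul.
exists e1, k1; split=> //; first by rewrite ek1 (leq_trans ke) // ltnW.
rewrite (leq_trans _ (leq_mul sum_le (leqnn _))) // mulSn.
rewrite -[X in (X <= _)%N](subnK (ltnW lt_em)) leq_add //.
exact: ltnW.
Qed.

(** A root of unity of exact order [k] has ['Phi_k] as minimal polynomial, which would then divide
    [f]. *)
Lemma cyclotomic_free_root (f : {poly rat}) (x : algC) m :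
  cyclotomic_free f -> root (pQC f) x -> (0 < m)%N -> x ^+ m != 1.
Proof.
move=> cf fx m0; apply/eqP => xm; have [k xk _] := prim_order_exists m0 xm.
have k0 := prim_order_gt0 xk.
have [q [qE _] qP] := minCpolyP x.
have := cf k k0; rewrite (_ : map_poly intr _ = q) -?qP ?fx //.
apply: (map_poly_inj (ratr : {rmorphism rat -> algC})).
by rewrite -qE (minCpoly_cyclotomic xk) -Cintr_Cyclotomic // -pZC_pQC.
Qed.

Lemma l1norm_le (P : {poly int}) (S : nat -> bool) N a : (size P <= N)%N ->
  (forall i, (i < N)%N -> (absz (P`_i)%R <= S i * a)%N) ->
  (l1norm P <= (\sum_(i < N) S i) * a)%N.
Proof.
move=> sP le_S; rewrite big_distrl /l1norm /=.
rewrite -(big_mkord xpredT (fun i => absz (P`_i)%R)) -(big_mkord xpredT (fun i => (S i * a)%N)).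
rewrite [X in (_ <= X)%N](@big_cat_nat _ _ _ (size P)) //= -[X in (X <= _)%N]addn0 leq_add //.
rewrite !big_nat; apply: leq_sum => i /andP[_ lt_i].
by rewrite le_S // (leq_trans lt_i).
Qed.

(** Integer counterpart of [nnz_coefs], as a sum so that it splits at a gap. *)
Definition weight (P : {poly int}) : nat := (\sum_(i < size P) (P`_i != 0)%R)%N.

(** If [f] does not divide the part [g0] of [G] below [k], some root [x] of [f] has smaller
    multiplicity in [g0]. Then some [theta^l], with [l] below the multiplicity in [f], leaves [g0]
    nonzero at [x] while annihilating [G] there. As [theta^l G] has the same gap, [gap_nat] applies
    to it. *)
Lemma gap_step (f : {poly rat}) (G : {poly int}) (e k d t c n : nat) :
  (size f).-1 = d -> (2 <= d)%N -> cyclotomic_free f -> ~~ root f 0 ->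
  f %| map_poly intr G -> G`_0 != 0 -> size G = n.+1 ->
  (forall i, (absz (G`_i)%R <= c)%N) -> (weight G <= t)%N -> (2 <= t)%N ->
  (e < k <= n)%N -> (forall i, (e < i < k)%N -> G`_i = 0) ->
  (n <= t.-1 * (k - e))%N ->
  Rle (INR n) (bound4p5 d t c) \/ f %| map_poly intr (take_poly k G).
Proof.
move=> df d2 cf f00 fG G0 sG Gc wG t2 /andP[ek kn] gap nu.
have f0 : f != 0 by apply: contraNneq f00 => ->; rewrite root0.
have [|ndvd] := boolP (f %| map_poly intr (take_poly k G)); [by right | left].
have n0 : (0 < n)%N by apply: leq_trans (leq_trans _ ek) kn.
pose S i := G`_i != 0.
have wS : (\sum_(i < n.+1) S i <= t)%N by rewrite -sG.
have [x [Q0 lt_mup]] : exists x, pZC (take_poly k G) != 0 /\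
    (mup x (pZC (take_poly k G)) < mup x (pQC f))%N.
  rewrite pZC_pQC; apply: not_dvdp_mup; first by rewrite map_poly_eq0.
  by rewrite dvdp_map.
set m := mup x (pQC f) in lt_mup.
have pf0 : pQC f != 0 by rewrite map_poly_eq0.
have fxm : ('X - x%:P) ^+ m %| pQC f by rewrite -mup_geq.
have fx : root (pQC f) x.
  by apply: contraLR lt_mup => nfx; rewrite /m (mupNroot nfx).
have x0 : x != 0.
  apply: contraNneq f00 => x0; move: fx.
  by rewrite x0 -(rmorph0 (ratr : {rmorphism rat -> algC})) fmorph_root.
have xn1 j : (0 < j)%N -> x ^+ j != 1 by apply: cyclotomic_free_root cf fx.
have [l lt_lm nroot] : exists2 l, (l < m)%N & ~~ root (iter l (@theta _) (pZC (take_poly k G))) x.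
  have [/existsP[l ?]|/existsPn no] := boolP
      [exists l : 'I_m, ~~ root (iter l (@theta _) (pZC (take_poly k G))) x].
    by exists l.
  move: lt_mup; rewrite ltnNge => /negP[]; rewrite mup_geq //; apply: dvdp_iter_theta => // l lt_l.
  by have := no (Ordinal lt_l); rewrite negbK.
have [q qx] := minpoly_exists x.
set a := (size q).-1.
have a0 : (0 < a)%N by rewrite /a -subn1 subn_gt0 (minpoly_size qx).
have sq : size q = a.+1 by rewrite prednK // (ltn_trans _ (minpoly_size qx)).
have la : (l.+1 * a <= d)%N.
  rewrite -df (leq_trans _ (mup_minpoly qx f0)) // leq_mul2r lt_lm orbT //.
have ad : (0 < a <= d)%N by rewrite a0 (leq_trans _ la) // leq_pmull.
have [p [pr_p lt_p Kp]] := prime_choice ad d2.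
pose H0 := iter l (@theta _) (take_poly k G).
pose H1 : {poly int} := \poly_(i < n.+1 - k) (G`_(i + k) *+ ((i + k) ^ l)).
have HE : iter l (@theta _) G = H0 + 'X^k * H1.
  apply/polyP => i; rewrite coefD coefXnM !coef_iter_theta coef_take_poly coef_poly.
  case: ltnP => ik; first by rewrite addr0.
  rewrite mul0rn add0r subnK //; case: ltnP => // le_i.
  by rewrite nth_default ?mul0rn // sG; rewrite leq_subLR subnKC in le_i.
have xG : ('X - x%:P) ^+ m %| pZC G.
  by apply: dvdp_trans fxm _; rewrite pZC_pQC dvdp_map.
have Hx : (pZC (H0 + 'X^k * H1)).[x] = 0.
  by apply/eqP; rewrite -rootE -HE map_iter_theta (root_iter_theta xG).
have H0x : (pZC H0).[x] != 0 by rewrite -rootE map_iter_theta.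
have H1x : (pZC H1).[x] != 0.
  apply: contraNneq H0x => H1x; move: Hx; rewrite rmorphD rmorphM hornerD hornerM H1x mulr0 addr0 => ->.
  by [].
have c1 : (1 <= c)%N by apply: leq_trans (Gc 0%N); rewrite absz_gt0.
have szH0 : (size H0 <= e.+1)%N.
  apply/leq_sizeP => i ei; rewrite coef_iter_theta coef_take_poly.
  by case: ltnP => ik; rewrite ?mul0rn // gap ?mul0rn // ei.
(* The constant term lies below the gap and the leading term above it, so each part has at most
   [t - 1] terms; [theta^l] scales a coefficient by at most [n^l]. *)
set C := (t.-1 * (c * n ^ l))%N.
have coef_le i : (i <= n)%N -> (absz (G`_i *+ (i ^ l))%R <= S i * (c * n ^ l))%N.
  move=> le_in; rewrite -mulr_natr abszM /S; case: eqP => [->|_]; first by rewrite absz0.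
  rewrite mul1n leq_mul //= natz absz_nat; case: (l) => // v; by rewrite leq_exp2r.
have C0 : (l1norm H0 <= C)%N.
  apply: (@leq_trans ((\sum_(i < n) S i) * (c * n ^ l))).
    apply: l1norm_le => [|i lt_i]; first by rewrite (leq_trans szH0) // (leq_trans ek).
    rewrite coef_iter_theta coef_take_poly; case: ltnP => ik; last by rewrite mul0rn absz0.
    exact/coef_le/ltnW.
  rewrite leq_mul2r; apply/orP; right.
  have := wS; rewrite big_ord_recr /= (_ : S n = true) ?addn1; last first.
    by rewrite /S -[n]/n.+1.-1 -sG -lead_coefE lead_coef_eq0 -size_poly_eq0 sG.
  by case: (t) t2.
have C1 : (l1norm H1 <= C)%N.
  apply: (@leq_trans ((\sum_(i < n.+1 - k) S (i + k)%N) * (c * n ^ l))).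
    apply: (@l1norm_le _ (fun i => S (i + k)%N)) => [|i lt_i]; first exact: size_poly.
    by rewrite coef_poly lt_i coef_le // -ltnS addnC -ltn_subRL.
  rewrite leq_mul2r; apply/orP; right.
  have := wS; rewrite -(big_mkord xpredT (fun i => nat_of_bool (S i))).
  rewrite (@big_cat_nat _ _ _ k) //=; last exact: (leq_trans kn).
  rewrite (big_ltn (leq_ltn_trans (leq0n e) ek)) (_ : S 0%N = true) //.
  have -> : (\sum_(k <= i < n.+1) S i = \sum_(i < n.+1 - k) S (i + k))%N.
    by rewrite -{1}[k]add0n big_addn big_mkord.
  case: (t) t2 => // t' _; rewrite add1n addSn ltnS; apply: leq_trans.
  exact: leq_addl.
have ue : (k - e <= k)%N by apply: leq_subr.
have sH0 : (size H0 <= (k - (k - e)).+1)%N by rewrite subKn // ltnW.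
have qp : (size q < p)%N by rewrite sq (leq_ltn_trans _ lt_p) // mulSn -addn1 leq_add2l muln_gt0.
have ineq := gap_nat qx x0 xn1 ue sH0 Hx H1x C0 C1 pr_p qp erefl.
apply: (@gap_bound_nat t c d a l n (k - e) p ((2 * a).-1 * p.+1)); try exact/ssrnat.leP.
- by apply/ssrnat.leP; rewrite subn_gt0.
- exact: Kp.
have := le_INR _ _ (ssrnat.leP ineq).
rewrite mult_INR !INR_expn !mult_INR INR_expn; exact.
Qed.

(** * Heights *)

Local Notation pZQ := (map_poly (intr : int -> rat)).

Lemma size_pZQ (P : {poly int}) : size (pZQ P) = size P.
Proof. by apply: size_map_inj_poly => //; apply: intr_inj. Qed.

Lemma sum_support_widen (R : nzRingType) (g : {poly R}) N : (size g <= N)%N ->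
  (\sum_(i < size g) (g`_i != 0)%R = \sum_(i < N) (g`_i != 0)%R)%N.
Proof.
move=> sN; pose S i := nat_of_bool (g`_i != 0)%R.
rewrite -(big_mkord xpredT S) -[RHS](big_mkord xpredT S) [RHS](big_cat_nat (leq0n _) sN) /=.
suff -> : (\sum_(size g <= i < N) S i = 0)%N by rewrite addn0.
by rewrite big_nat_cond big1 // => i /andP[/andP[le_i _] _]; rewrite /S nth_default ?eqxx.
Qed.

Lemma nnz_coefsE (g : {poly rat}) N : (size g <= N)%N ->
  nnz_coefs g = (\sum_(i < N) (g`_i != 0)%R)%N.
Proof.
move=> sN; rewrite /nnz_coefs -sum1_card big_mkcond /= -(sum_support_widen sN).
by apply: eq_bigr => i _; rewrite inE; case: eqP.
Qed.

Lemma nnz_coefs_weight (g : {poly rat}) (P : {poly int}) r : r != 0 ->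
  pZQ P = r *: g -> nnz_coefs g = weight P.
Proof.
move=> r0 PE; have sz : size g = size P by rewrite -size_pZQ PE size_scale.
rewrite (@nnz_coefsE _ (size P)) ?sz //; apply: eq_bigr => i _.
have := congr1 (fun Q : {poly rat} => Q`_i) PE; rewrite coef_map coefZ /= => E.
by rewrite -(intr_eq0 rat) E mulf_eq0 (negPf r0).
Qed.

Lemma height_le_int (g : {poly rat}) c : height_le g c ->
  exists2 r : rat, r != 0 & exists2 P : {poly int}, pZQ P = r *: g &
    forall i, (absz (P`_i)%R <= c)%N.
Proof.
case=> h [[g0 [r [r0 int_rg _ hE]]] hc]; exists r; first by rewrite gt_eqF.
have /floorpP[P PE] : r *: g \is a polyOver Num.int by apply/polyOverP.
exists P => // i; rewrite -(ler_nat rat) (le_trans _ hc) // hE.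
have -> : (absz (P`_i)%R)%:R = `|(r *: g)`_i| :> rat.
  by rewrite PE coef_map /= -intr_norm natr_absz.
have [lt_i|le_i] := ltnP i (size g); first exact: (le_bigmax _ _ (Ordinal lt_i)).
rewrite [(r *: g)`_i]nth_default ?normr0; last by rewrite size_scale ?gt_eqF.
exact: bigmax_ge_id.
Qed.

(** Clearing the denominator of [N] and comparing contents shows that [N] is the content of the
    integral product. *)
Lemma zprimitive_scale_int (P : {poly int}) (N : rat) : P != 0 ->
  Defs.integral_poly (N *: pZQ (zprimitive P)) -> N \is a Num.int.
Proof.
move=> P0 int_N.
have /floorpP[R RE] : N *: pZQ (zprimitive P) \is a polyOver Num.int by apply/polyOverP.
have E : numq N *: zprimitive P = denq N *: R.
  apply: (@map_inj_poly _ _ (intr : int -> rat)) => //; first exact: intr_inj.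
  by rewrite !map_polyZ /= -RE scalerA numqE mulrC.
have := congr1 zcontents E; rewrite !zcontentsZ zcontents_primitive P0 mulr1 => NE.
have -> : N = (zcontents R)%:~R.
  by rewrite -[LHS]divq_num_den NE intrM mulrAC divff ?mul1r // intr_eq0 denq_neq0.
exact: intr_int.
Qed.

(** The least admissible scaling is the inverse of the absolute content, so the height is read off
    the primitive part, whose coefficients divide those of [P]. *)
Lemma height_le_of_int (P : {poly int}) c : P != 0 ->
  (forall i, (absz (P`_i)%R <= c)%N) -> height_le (pZQ P) c.
Proof.
move=> P0 le_c; have z0 : zcontents P != 0 by rewrite zcontents_eq0.
have zQ0 : (zcontents P)%:~R != 0 :> rat by rewrite intr_eq0.
set z : rat := `|(zcontents P)%:~R|.
have z_gt0 : 0 < z by rewrite normr_gt0.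
have scaleE (s : rat) : s *: pZQ P = (s * (zcontents P)%:~R) *: pZQ (zprimitive P).
  by rewrite {1}[P]zpolyEprim map_polyZ /= scalerA.
have coefE i : `|(z^-1 *: pZQ P)`_i| = `|((zprimitive P)`_i)%:~R|.
  rewrite scaleE coefZ coef_map /= !normrM normrV ?unitfE ?gt_eqF //.
  by rewrite normr_id mulVf ?mul1r ?gt_eqF.
exists (\big[Num.max/0]_(i < size (pZQ P)) `|(z^-1 *: pZQ P)`_i|); split; last first.
  apply/bigmax_leP; split=> [|i _]; first exact: ler0n.
  rewrite coefE -intr_norm -natr_absz ler_nat (leq_trans _ (le_c i)) //.
  move: (nat_of_ord i) => j; rewrite {2}[P]zpolyEprim coefZ abszM leq_pmull //.
  by rewrite absz_gt0.
split; first by rewrite -size_poly_eq0 size_pZQ size_poly_eq0.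
exists z^-1; split=> //; first by rewrite invr_gt0.
  have int_sgn : z^-1 * (zcontents P)%:~R \is a Num.int.
    have [h|h] := leP 0 ((zcontents P)%:~R : rat).
      by rewrite /z ger0_norm // mulVf.
    by rewrite /z ltr0_norm // invrN mulNr mulVf // rpredN.
  by move=> i; rewrite scaleE coefZ coef_map /= rpredM ?intr_int.
move=> r r0; rewrite scaleE => /(zprimitive_scale_int P0) int_r.
rewrite -div1r ler_pdivrMr // -[r]gtr0_norm // -normrM.
by rewrite norm_intr_ge1 // mulf_neq0 // gt_eqF.
Qed.

Lemma good_of_int f t c (P : {poly int}) : P != 0 -> f %| pZQ P -> (weight P <= t)%N ->
  (forall i, (absz (P`_i)%R <= c)%N) -> good_multiple f t c (pZQ P).
Proof.
move=> P0 fP wP Pc; split=> //; last exact: height_le_of_int.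
  by rewrite -size_poly_eq0 size_pZQ size_poly_eq0.
by rewrite /sparse (@nnz_coefs_weight _ P 1) ?scale1r ?oner_eq0.
Qed.

(** * Powers of [X], factors of degree at most one, and descent on the degree *)

Lemma dvdp_mulXn_cancel (P f : {poly rat}) s : ~~ root f 0 ->
  f %| 'X^s * P -> f %| P.
Proof.
by move=> f0; rewrite Gauss_dvdpr // coprimep_expr // coprimepX.
Qed.

Lemma weight_mulXn (P : {poly int}) s : weight ('X^s * P) = weight P.
Proof.
rewrite /weight (@sum_support_widen _ _ (s + size P)); last first.
  by rewrite (leq_trans (size_mul_leq _ _)) // size_polyXn.
rewrite big_split_ord /= big1 ?add0n => [|i _]; last by rewrite coefXnM ltn_ord eqxx.
by apply: eq_bigr => i _; rewrite coefXnM ltnNge leq_addr /= addKn.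
Qed.

Lemma coef_bound_mulXn (P : {poly int}) s c : (forall i, (absz (P`_i)%R <= c)%N) ->
  forall i, (absz (('X^s * P)`_i)%R <= c)%N.
Proof. by move=> le_c i; rewrite coefXnM; case: ltnP; rewrite ?absz0. Qed.

Lemma root0_coef0 (R : nzRingType) (P : {poly R}) : root P 0 = (P`_0 == 0).
Proof. by rewrite rootE horner_coef0. Qed.

Lemma split_Xn (R : idomainType) (P : {poly R}) : P != 0 ->
  exists s Q, ~~ root Q 0 /\ P = 'X^s * Q.
Proof.
move=> P0; have [s [Q]] := multiplicity_XsubC P 0.
by rewrite P0 /= subr0 => Q0 ->; exists s, Q; split=> //; rewrite mulrC.
Qed.

(** By Gauss' lemma the primitive multiple of [f] divides [G] over the integers. Its constant and
    leading coefficients, which are all it has, divide those of [G]. *)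
Lemma int_factor_bound (f : {poly rat}) (G : {poly int}) c : (0 < size f <= 2)%N ->
  f %| pZQ G -> G`_0 != 0 -> (forall i, (absz (G`_i)%R <= c)%N) ->
  exists F : {poly int}, [/\ size F = size f, f %| pZQ F & forall i, (absz (F`_i)%R <= c)%N].
Proof.
move=> /andP[f0 f2] fG G0 Gc.
have [P [a a0 fE]] := rat_poly_scale f.
have a0' : (a%:~R)^-1 != 0 :> rat by rewrite invr_eq0 intr_eq0.
have sF : size (zprimitive P) = size f by rewrite size_zprimitive fE size_scale // size_pZQ.
have P0 : P != 0 by rewrite -size_poly_gt0 -size_zprimitive sF.
have fP : f %= pZQ P by rewrite fE eqp_scale.
have [R GE] : {R | G = zprimitive P * R}.
  by apply: dvdpP_int; rewrite -dvdp_rat_int -(eqp_dvdl _ fP).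
have G00 : G != 0 by apply: contraNneq G0 => ->; rewrite coef0.
exists (zprimitive P); split=> //.
  rewrite (eqp_dvdl _ fP) [X in pZQ X %| _]zpolyEprim map_polyZ /= dvdpZl // intr_eq0 zcontents_eq0 //.
have le_of_mul (x y : int) : x * y != 0 -> (absz (x * y)%R <= c)%N -> (absz x <= c)%N.
  rewrite mulf_eq0 negb_or abszM => /andP[_ y0]; apply: leq_trans.
  by rewrite leq_pmulr // absz_gt0.
have F0 : (absz ((zprimitive P)`_0)%R <= c)%N.
  apply: (le_of_mul _ (R`_0)); rewrite -coef0M -GE //.
have F1 : (absz (lead_coef (zprimitive P))%R <= c)%N.
  apply: (le_of_mul _ (lead_coef R)); rewrite -lead_coefM -GE ?lead_coef_eq0 //.
  by rewrite lead_coefE Gc.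
case=> [|[|i]] //; last by rewrite nth_default // sF (leq_trans f2).
have [le1|gt1] := leqP (size (zprimitive P)) 1; first by rewrite nth_default.
by move: F1; rewrite lead_coefE (_ : (size _).-1 = 1)%N //; lia.
Qed.

Lemma weight_take_poly (P : {poly int}) k : (weight (take_poly k P) <= weight P)%N.
Proof.
rewrite /weight (@sum_support_widen _ _ (maxn k (size P))); last first.
  by rewrite (leq_trans (size_take_poly _ _)) // leq_maxl.
rewrite (@sum_support_widen _ P (maxn k (size P))) ?leq_maxr //.
apply: leq_sum => i _; rewrite coef_take_poly.
by case: ltnP; rewrite ?eqxx.
Qed.

(* Truncating at a long gap keeps the constant coefficient, so one can descend on the
   degree without minimality. *)
Lemma sparse_multiple_of_bounded_degree (f : {poly rat}) (d t c : nat) (G : {poly int}) :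
  (size f).-1 = d -> (2 <= d)%N -> cyclotomic_free f -> ~~ root f 0 -> (2 <= t)%N ->
  f %| pZQ G -> G`_0 != 0 -> (forall i, (absz (G`_i)%R <= c)%N) -> (weight G <= t)%N ->
  exists H : {poly int}, [/\ H != 0, f %| pZQ H, forall i, (absz (H`_i)%R <= c)%N,
    (weight H <= t)%N & Rle (INR (size H).-1) (bound4p5 d t c)].
Proof.
move=> df d2 cf f0 t2; have [N] := ubnP (size G); elim: N G => // N IH G.
rewrite ltnS => szG fG G0 Gc wG.
have Gn0 : G != 0 by apply: contraNneq G0 => ->; rewrite coef0.
have sG : size G = (size G).-1.+1 by rewrite prednK // size_poly_gt0.
set n := (size G).-1 in sG.
have n0 : (0 < n)%N.
  have : (size f <= size G)%N.
    by rewrite -size_pZQ dvdp_leq // -size_poly_eq0 size_pZQ size_poly_eq0.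
  by rewrite sG; move: df d2; move: (size f) => a <-; lia.
have Gn : G`_n != 0 by rewrite -lead_coefE lead_coef_eq0.
have [e [k [ekn _ _ gap nu]]] := @pick_gap (fun i => G`_i != 0) n G0 Gn n0.
have gap0 i : (e < i < k)%N -> G`_i = 0 by move/gap; rewrite negbK => /eqP.
have sum_t : ((\sum_(i < n) (G`_i != 0)%R)%N <= t.-1)%N.
  by move: wG; rewrite /weight sG big_ord_recr /= Gn addn1; case: (t) t2.
have nu' : (n <= t.-1 * (k - e))%N by rewrite (leq_trans nu) // leq_mul2r sum_t orbT.
have [le_n|fk] := gap_step df d2 cf f0 fG G0 sG Gc wG t2 ekn gap0 nu'.
  by exists G; split.
have k0 : (0 < k)%N by case/andP: ekn => /(leq_ltn_trans (leq0n _)).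
apply: (IH (take_poly k G)) => //.
- rewrite (leq_ltn_trans (size_take_poly _ _)) // (leq_trans _ szG) // sG ltnS.
  by case/andP: ekn.
- by rewrite coef_take_poly k0.
- by move=> i; rewrite coef_take_poly; case: ltnP; rewrite ?absz0.
- exact: leq_trans (weight_take_poly G k) wG.
Qed.
Local Close Scope ring_scope.

Theorem theorem4p5 (f : {poly rat}) (d t c n : nat) :
  (size f).-1 = d -> (1 <= d)%N ->
  cyclotomic_free f ->
  (2 <= t)%N ->
  (exists g, good_multiple f t c g) ->
  (* n is the smallest degree of a nonzero t-sparse multiple of f of height <= c *)
  (exists g, good_multiple f t c g /\ (size g).-1 = n) ->
  (forall g, good_multiple f t c g -> (n <= (size g).-1)%N) ->
  Rle (INR n) (bound4p5 d t c).
Proof.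
move=> df d1 cf t2 _ [g [[g0 fg sg hg] _]] nmin.
have f0 : f != 0%R by rewrite -size_poly_gt0; case: (size f) df d1 => // <-.
have [r r0 [P PE Pc]] := height_le_int hg.
have P0 : P != 0%R.
  by rewrite -size_poly_eq0 -size_pZQ PE size_scale // size_poly_eq0.
have wP : (weight P <= t)%N by rewrite -(nnz_coefs_weight r0 PE).
have fP : (f %| pZQ P)%R by rewrite PE dvdpZr.
(* Powers of [X] are stripped from [f] and from its multiple, so that both have nonzero constant
   term. *)
have [s [f' [f'0 fE]]] := split_Xn f0.
have [v [G [G0 GE]]] := split_Xn P0.
have f'n0 : f' != 0%R by apply: contraNneq f'0 => ->; rewrite root0.
have sf : size f = (s + size f')%N by rewrite fE size_monicM ?monicXn // size_polyXn.
have f'G : (f' %| pZQ G)%R.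
  apply: (@dvdp_mulXn_cancel _ _ v) => //.
  have -> : ('X^v * pZQ G = pZQ P)%R by rewrite GE rmorphM /= map_polyXn.
  by apply: dvdp_trans fP; rewrite fE dvdp_mulIr.
have Gc i : (absz (G`_i)%R <= c)%N.
  by have := Pc (v + i)%N; rewrite GE coefXnM ltnNge leq_addr /= addKn.
have wG : (weight G <= t)%N by rewrite -(weight_mulXn G v) -GE.
rewrite root0_coef0 in G0.
(* Multiplying by [X^s] turns an admissible multiple of [f'] into one of [f], to which the
   minimality of [n] applies. *)
have shift (H : {poly int}) : H != 0%R -> (f' %| pZQ H)%R ->
    (forall i, (absz (H`_i)%R <= c)%N) -> (weight H <= t)%N -> (n <= s + (size H).-1)%N.
  move=> H0 fH Hc wH; have Hs0 : ('X^s * H != 0)%R by rewrite mulf_neq0 // monic_neq0 ?monicXn.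
  have : good_multiple f t c (pZQ ('X^s * H)).
    apply: good_of_int => //; last exact: coef_bound_mulXn.
      by rewrite rmorphM /= map_polyXn fE dvdp_mul2l // monic_neq0 ?monicXn.
    by rewrite weight_mulXn.
  move/nmin; rewrite size_pZQ size_monicM ?monicXn // size_polyXn.
  by rewrite -size_poly_gt0 in H0; case: (size H) H0 => // m _; rewrite addSn addnS.
have cf' : cyclotomic_free f'.
  by move=> k k0; apply: contra (cf k k0) => kf; rewrite fE dvdp_mull.
have t1 := INR_sub1_ge1 t (ssrnat.leP t2).
have f'gt0 : (0 < size f')%N by rewrite size_poly_gt0.
have [d2|d2] := leqP 2 (size f').-1.
  have [H [H0 fH Hc wH le_H]] := sparse_multiple_of_bounded_degree erefl d2 cf' f'0 t2 f'G G0 Gc wG.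
  have -> : d = ((size f').-1 + s)%N by rewrite -df sf; case: (size f') f'gt0 => // m _; rewrite addnS addnC.
  apply: Rle_trans (bound_add t c t1 _ s _); last exact: (le_INR 2 _ (ssrnat.leP d2)).
  apply: Rle_trans (Rplus_le_compat_r _ _ _ le_H).
  rewrite -plus_INR; apply/le_INR/ssrnat.leP; rewrite -[Nat.add _ _]/(_ + _)%N addnC; exact: shift.
(* In degree at most one the primitive multiple of [f'] has at most two terms and is admissible, so
   [n <= d]. *)
have sf' : (0 < size f' <= 2)%N by rewrite f'gt0; case: (size f') d2.
have [F [sF fF Fc]] := int_factor_bound sf' f'G G0 Gc.
apply: Rle_trans (bound_ge_degree t c t1 d _); last exact: (le_INR 1 _ (ssrnat.leP d1)).
apply/le_INR/ssrnat.leP; rewrite -df sf.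
have -> : (s + size f').-1 = (s + (size F).-1)%N.
  by rewrite sF; case: (size f') f'gt0 => // m _; rewrite addnS.
apply: shift => //; first by rewrite -size_poly_gt0 sF.
apply: leq_trans t2; apply: leq_trans (_ : size F <= _)%N; last by rewrite sF; case/andP: sf'.
rewrite /weight -[X in (_ <= X)%N]card_ord -sum1_card; apply: leq_sum => i _; exact: leq_b1.
Qed.
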